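(* Let $n_0\ge0$ be an integer, $0<\alpha\le1$, and let $\lambda_{(n)_i}>0$ ($n\ge n_0$, $i\ge1$) satisfy $\sum_{i=1}^{\infty}\lambda_{(n)_i}<\infty$ for all $n\ge n_0$. Let $\{\mathcal{X}_1^{\alpha}(t)\}_{t\ge0}$ be the process whose state probabilities $p_1^{\alpha}(n,t)=\mathrm{Pr}\{\mathcal{X}_1^{\alpha}(t)=n\}$ satisfy $$\frac{\mathrm{d}^{\alpha}}{\mathrm{d}t^{\alpha}}p_1^{\alpha}(n,t)=-\sum_{i=1}^{\infty}\lambda_{(n)_i}p_1^{\alpha}(n,t)+\sum_{i=1}^{n}\lambda_{(n-i)_i}p_1^{\alpha}(n-i,t),\quad n\ge n_0,$$ with $p_1^{\alpha}(n_0,0)=1$ and $p_1^{\alpha}(n,0)=0$ for $n>n_0$, and let $\{\mathcal{X}_1(t)\}_{t\ge0}$ be its non-fractional version (the case $\alpha=1$). Let $\{T_{2\alpha}(t)\}_{t>0}$ be a process independent of $\{\mathcal{X}_1(t)\}$ whose one-dimensional distribution is the folded solution $f_{T_{2\alpha}}(x,t)$ of the fractional diffusion equation described in the context. Then for each $t>0$ $$\mathcal{X}_1^{\alpha}(t)\overset{d}{=}\mathcal{X}_1(T_{2\alpha}(t)),$$ where $\overset{d}{=}$ denotes equality in distribution.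
   Context: Caputo derivative: for $0<\alpha<1$, $\frac{\mathrm{d}^{\alpha}}{\mathrm{d}t^{\alpha}}f(t)=\frac{1}{\Gamma(1-\alpha)}\int_0^t(t-s)^{-\alpha}f'(s)\,\mathrm{d}s$; for $\alpha=1$ it is $f'(t)$ (and for orders in $(1,2]$ it is the usual Caputo derivative). Convention: $p_1^{\alpha}(n,t)=0$ for $n<n_0$. The process $\{\mathcal{X}_1(t)\}$ starts at $n_0$ and from state $n$ jumps to $n+i$, $i\ge1$, with rate $\lambda_{(n)_i}$. $f_{T_{2\alpha}}(x,t)$ is the folded solution (i.e. $2u(x,t)$ for $x>0$ and $0$ for $x<0$) of $$\frac{\mathrm{d}^{2\alpha}}{\mathrm{d}t^{2\alpha}}u(x,t)=\frac{\partial^2}{\partial x^2}u(x,t),\quad x\in\mathbb{R},\ t>0,$$ with $u(x,0)=\delta(x)$ for $0<\alpha\le1$ and $\frac{\partial}{\partial t}u(x,0)=0$ for $1/2<\alpha\le1$. It is known that $\int_0^{\infty}e^{-st}f_{T_{2\alpha}}(x,t)\,\mathrm{d}t=s^{\alpha-1}e^{-xs^{\alpha}}$ for $x>0$ (for $\alpha=1$ the density is understood in the generalized sense). *)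

(* Defs.v *)
From HB Require Import structures.
From mathcomp Require Import all_boot all_order all_algebra.
From mathcomp Require Import all_classical all_reals all_analysis.

Set Implicit Arguments.
Unset Strict Implicit.
Unset Printing Implicit Defensive.

Import Order.TTheory GRing.Theory Num.Theory.
Import numFieldNormedType.Exports.

Local Open Scope ring_scope.
Local Open Scope classical_set_scope.

Definition Gamma (R : realType) (x : R) : R :=
  \int[@lebesgue_measure R]_(t in `]0, +oo[) (t `^ (x - 1) * expR (- t)).

(* Local absolute continuity on the open half line ]0, +oo[ of a function with
   derivative g^`(), this derivative being integrable up to the origin. *)
Definition loc_abs_cont (R : realType) (g : R -> R) : Prop :=
  forall s t : R, 0 < s -> s <= t ->
    (@lebesgue_measure R).-integrable `]0, t] (EFin \o g^`()) /\
    g t - g s = \int[@lebesgue_measure R]_(r in `]s, t]) derive1 g r.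

Definition caputo_degree (R : realType) (b : R) : nat := `|Num.ceil b|%N.

(* Caputo derivative of order b > 0 with m - 1 < b <= m:
     1 / Gamma (m - b) * \int_0^t (t - s)^(m - b - 1) f^(m)(s) ds   if b < m,
     f^(m)(t)                                                       if b = m.
   For 0 < b < 1 we have m = 1 and the exponent is - b. Since integrals and
   derivatives are total functions here, this value is only meaningful together
   with [caputo_derivable]. *)
Definition caputo (R : realType) (b : R) (f : R -> R) (t : R) : R :=
  let m := caputo_degree b in
  if b == m%:R then f^`(m) t
  else (Gamma (m%:R - b))^-1 *
       \int[@lebesgue_measure R]_(s in `]0, t[)
          ((t - s) `^ (m%:R - b - 1) * derive1n m f s).

(* Existence of the Caputo derivative of order b at all times t > 0: f is
   continuous at the origin, f, ..., f^(m-1) are locally absolutely continuous,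
   and the m-th derivative (if b = m) or the convolution integral (if b < m)
   exists at every t > 0. Values of f at negative arguments are irrelevant. *)
Definition caputo_derivable (R : realType) (b : R) (f : R -> R) : Prop :=
  let m := caputo_degree b in
  [/\ f x @[x --> 0^'+] --> f 0,
      forall k : nat, (k < m)%N -> loc_abs_cont f^`(k)
    & forall t : R, 0 < t ->
        if b == m%:R then derivable f^`(m.-1) t 1
        else (@lebesgue_measure R).-integrable `]0, t[
               (fun s => ((t - s) `^ (m%:R - b - 1) * derive1n m f s)%:E)].

Definition test_function (R : realType) (phi : R -> R) : Prop :=
  (forall (k : nat) (x : R), derivable phi^`(k) x 1) /\
  (exists M : R, forall x : R, M < `|x| -> phi x = 0).

(* Solution of d^b u / dt^b = d^2 u / dx^2 on the real line, with initial
   condition u(x, 0) = delta(x) and, when b > 1, du/dt(x, 0) = 0. Here u t is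
   the law u(x, t) dx; it is a measure because the initial value is a Dirac
   mass, and so is u(., t) itself when b = 2. The equation holds in the sense of
   distributions in x: for b <> 1 the densities have a kink at x = 0, so that it
   cannot hold pointwise there. The limit at 0+ of the first derivative is the
   right derivative at t = 0. *)
Definition fractional_diffusion (R : realType) (b : R)
    (u : R -> probability R R) : Prop :=
  (forall A : set R, measurable A -> u 0 A = \d_(0 : R) A) /\
  forall phi : R -> R, test_function phi ->
    let g := fun t : R => \int[u t]_x phi x in
    [/\ caputo_derivable b g,
        forall t : R, 0 < t -> caputo b g t = \int[u t]_x derive1n 2 phi x
      & 1 < b -> g^`() t @[t --> 0^'+] --> (0 : R)].

(* A process with one-dimensional distributions the folded solution: density
   2 u(x, t) for x > 0 and 0 for x < 0. It takes nonnegative values, so that it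
   can be used as a random time. *)
Definition folded_diffusion_process (R : realType) (b : R)
    (d : measure_display) (Om : measurableType d) (P : probability Om R)
    (T : R -> Om -> R) : Prop :=
  [/\ forall t : R, 0 < t -> measurable_fun [set: Om] (T t),
      forall (t : R) (w : Om), 0 < t -> 0 <= T t w
    & exists u : R -> probability R R,
        fractional_diffusion b u /\
        forall (t : R) (A : set R), 0 < t -> measurable A ->
          P (T t @^-1` A) = (2%:E * u t (A `&` `]0%R, +oo[))%E].

(* Processes with values in the discrete space option nat: Some n is the state
   n, and None is a cemetery for the mass lost by explosion, which the
   assumptions on the rates do not exclude. A process in nat is the special
   case where None is not visited. *)
Definition state_prob (R : realType) (d : measure_display)
    (Om : measurableType d) (P : probability Om R)
    (X : R -> Om -> option nat) (n : nat) (t : R) : R :=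
  fine (P (X t @^-1` [set Some n])).

Definition fractional_birth_process (R : realType) (n0 : nat) (a : R)
    (lambda : nat -> nat -> R) (d : measure_display) (Om : measurableType d)
    (P : probability Om R) (X : R -> Om -> option nat) : Prop :=
  let p := state_prob P X in
  [/\ forall (t : R) (A : set (option nat)), 0 <= t -> measurable (X t @^-1` A),
      forall (n : nat) (t : R), (n < n0)%N -> 0 <= t -> p n t = 0,
      p n0 0 = 1,
      forall n : nat, (n0 < n)%N -> p n 0 = 0
    & forall n : nat, (n0 <= n)%N ->
        caputo_derivable a (p n) /\
        forall t : R, 0 < t ->
          caputo a (p n) t =
            - fine (\sum_(1 <= i <oo) (lambda n i * p n t)%:E)%E
            + \sum_(1 <= i < n.+1) lambda (n - i)%N i * p (n - i)%N t].

(* Paths of a jump process: right-continuous for the discrete topology on the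
   state space. *)
Definition step_paths (R : realType) (Om S : Type) (X : R -> Om -> S) : Prop :=
  forall (w : Om) (t : R), 0 <= t -> \forall s \near t^'+, X s w = X t w.

Definition process_events (R : realType) (Om S : Type) (I : set R)
    (E : set (set S)) (X : R -> Om -> S) : set (set Om) :=
  <<s [set X t @^-1` A | t in I & A in E] >>.

Definition independent_events (R : realType) (d : measure_display)
    (Om : measurableType d) (P : probability Om R) (F G : set (set Om)) : Prop :=
  forall A B : set Om, F A -> G B -> P (A `&` B) = (P A * P B)%E.

Definition time_change (R : realType) (Om S : Type) (X : R -> Om -> S)
    (T : R -> Om -> R) : R -> Om -> S :=
  fun t w => X (T t w) w.

Definition eq_in_distribution (R : realType) (S : Type)
    (d1 : measure_display) (Om1 : measurableType d1) (P1 : probability Om1 R)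
    (Y1 : Om1 -> S)
    (d2 : measure_display) (Om2 : measurableType d2) (P2 : probability Om2 R)
    (Y2 : Om2 -> S) (E : set (set S)) : Prop :=
  forall A : set S, E A -> P1 (Y1 @^-1` A) = P2 (Y2 @^-1` A).

(* Main.v *)
Require Import Defs.
From HB Require Import structures.
From mathcomp Require Import all_boot all_order all_algebra.
From mathcomp Require Import all_classical all_reals all_analysis measurable_realfun.
From mathcomp Require Import ring lra.

Set Implicit Arguments.
Unset Strict Implicit.
Unset Printing Implicit Defensive.

Import Order.TTheory GRing.Theory Num.Theory.
Import numFieldNormedType.Exports.

Local Open Scope ring_scope.
Local Open Scope classical_set_scope.

(** The proof compares Laplace transforms in time. Write [p n] for the state
    probabilities of the non-fractional process, [T] for the random time,
    [s] for the Laplace variable and [r] for [s `^ alpha].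

    On the fractional side, integrating the Caputo derivative of order [b] as
    often as its degree gives the convolution of a power with [f - f 0]
    ([prim_convol]). If [f] and its Caputo derivative are bounded, Laplace
    transforms therefore obey
    [lap (caputo b f) s = s `^ b * (lap f s - f 0 / s)] ([lap_caputo]), without
    any growth condition on the ordinary derivatives of [f]. Applied to the
    state probabilities of the fractional process, this is a triangular linear
    system ([lap_state_prob]).

    On the other side, [hexp u f t] is the mean of [f (T t)]. For a test
    function supported in the open half line, the diffusion equation and
    [lap_caputo] say that the functional [L f = lap (hexp u f) s] satisfies
    [L f'' = r ^ 2 * L f] ([lap_hexp_test]); the Dirac mass at the origin is not
    seen by such functions. Since [L] is a bounded functional, cutting off at
    infinity extends this to bounded smooth functions that vanish on the
    negative half line ([lap_hexp_derive2]). Solving [phi' + r * phi = psi]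
    inside this class and using [phi'' - r ^ 2 * phi = psi' - r * psi] removes
    the exponentially growing solution: [L psi' = r * L psi]
    ([lap_hexp_derive1_flat]). Cutting off at the origin and using that [L 1] is
    [1 / s] gives [L f' = r * (L f - f 0 / s)] for every bounded smooth [f] with
    bounded derivative ([lap_hexp_derive1]). In other words [L] is the integral
    against the density [s `^ (alpha - 1) * expR (- r * x)], the known transform
    of the folded solution.

    The functions [p n] are smooth on the open half line by induction from
    their differential equations, so [L (p n)] solves the same triangular system
    as the transform of the fractional state probability
    ([lap_hexp_state_prob]). The system has one solution ([triangular_unique]);
    the two functions of time are continuous ([hexp_continuous]), and a bounded
    function whose transform vanishes is zero wherever it is continuous
    ([lap_unique]). Hence the fractional state probability at time [t] is the
    mean of [p n (T t)]. That this mean is the probability that [X (T t)] is [n]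
    follows by approximating [T t] from the right by grid values, on which
    independence can be used, and by right continuity of the paths
    ([random_time_prob]). *)

(** * Measure-preserving maps of the real line *)

Section affine.
Context {R : realType}.
Local Notation leb := (@lebesgue_measure R).

Lemma measurable_affine (c d : R) :
  measurable_fun setT (fun x : measurableTypeR R => c * x + d : measurableTypeR R).
Proof.
apply: measurable_funD => //; exact: measurable_funM.
Qed.

Lemma lebesgue_affine (c d : R) (A : set R) : 0 < c -> measurable A ->
  leb ((fun x => c * x + d) @^-1` A) = (c^-1%:E * leb A)%E.
Proof.
move=> c0 mA.
have mf := measurable_affine c d.
pose nu := mscale (NngNum (ltW c0))
  (pushforward leb (fun x : measurableTypeR R => c * x + d : measurableTypeR R)).
have -> : leb A = nu mf A.
  apply: (@lebesgue_measure_unique R (nu mf)) => //= _ [[a b]] _ <-.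
  rewrite /nu/= /mscale/= /pushforward/=.
  have -> : (fun x => c * x + d) @^-1` `]a, b] = `](a - d) / c, (b - d) / c]%classic.
    apply/seteqP; split => x /=; rewrite !in_itv/= ltr_pdivrMr// ler_pdivlMr//;
      rewrite ltrBlDr lerBrDr mulrC//.
  rewrite !lebesgue_measure_itv/= !lte_fin ltr_pM2r ?invr_gt0// ltrD2r.
  case: ifP => _; last by rewrite mule0.
  by rewrite -EFinB -!EFinD -EFinM; congr EFin; field; rewrite gt_eqF.
rewrite /nu/= /mscale/= muleA -EFinM mulVf ?gt_eqF// mul1e//.
Qed.

Definition measure_preserving (phi : R -> R) :=
  measurable_fun setT (phi : measurableTypeR R -> measurableTypeR R) /\
  forall A, measurable A -> leb (phi @^-1` A) = leb A.

Lemma measure_preserving_shift d : measure_preserving (fun x => x + d).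
Proof.
split; first by have := measurable_affine 1 d; under eq_fun do rewrite mul1r.
move=> A mA; have := lebesgue_affine d ltr01 mA.
by rewrite invr1 mul1e; under eq_fun do rewrite mul1r.
Qed.

Lemma measure_preserving_opp : measure_preserving -%R.
Proof. by split; [exact: oppr_measurable|move=> A mA; exact: lebesgue_measureN]. Qed.

Lemma measure_preserving_comp f g :
  measure_preserving f -> measure_preserving g -> measure_preserving (f \o g).
Proof.
move=> [mf pf] [mg pg]; split; first exact: measurableT_comp.
move=> A mA; rewrite comp_preimage pg ?pf//.
by rewrite -[X in measurable X]setTI; exact: mf.
Qed.

Lemma measure_preserving_reflect t : measure_preserving (fun x => t - x).
Proof.
have := measure_preserving_comp (measure_preserving_shift t) measure_preserving_opp.
by congr measure_preserving; apply/funext => x /=; rewrite addrC.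
Qed.

Lemma ge0_integral_preserving phi (f : R -> \bar R) : measure_preserving phi ->
  measurable_fun setT f -> (forall x, 0 <= f x)%E ->
  (\int[leb]_x f (phi x) = \int[leb]_x f x)%E.
Proof.
move=> [mphi pphi] mf f0.
have := @ge0_integral_pushforward _ _ _ _ R _ mphi leb _ _ measurableT mf
  (fun y _ => f0 y).
rewrite preimage_setT /= => <-.
by apply: eq_measure_integral => A mA _; exact: pphi.
Qed.

Lemma integrable_preserving phi (f : R -> \bar R) : measure_preserving phi ->
  leb.-integrable setT f -> leb.-integrable setT (f \o phi).
Proof.
move=> pphi /integrableP[mf fi]; apply/integrableP; split.
  by case: pphi => mphi _; exact: measurableT_comp mf mphi.
rewrite /= (@ge0_integral_preserving phi (fun x => `|f x|%E))//.
exact: measurableT_comp.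
Qed.

Lemma integral_preserving phi (f : R -> \bar R) : measure_preserving phi ->
  leb.-integrable setT f ->
  (\int[leb]_x f (phi x) = \int[leb]_x f x)%E.
Proof.
move=> pphi fi; have ci := integrable_preserving pphi fi.
have [mphi p] := pphi.
have := @integral_pushforward _ _ _ _ R _ mphi leb setT f (measurable_int _ fi).
rewrite preimage_setT => /(_ ci measurableT) /= <-.
by apply: eq_measure_integral => A mA _; exact: p.
Qed.

Lemma ge0_integral_scale c (f : R -> \bar R) : 0 < c ->
  measurable_fun setT f -> (forall x, 0 <= f x)%E ->
  (\int[leb]_x f (c * x)%R = c^-1%:E * \int[leb]_x f x)%E.
Proof.
move=> c0 mf f0.
have mphi := measurable_affine c 0.
have ci0 : 0 <= c^-1 by rewrite invr_ge0 ltW.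
have := @ge0_integral_pushforward _ _ _ _ R _ mphi leb _ _ measurableT mf
  (fun y _ => f0 y).
rewrite preimage_setT /= => h.
under eq_integral do rewrite -[(c * _)%R]addr0.
rewrite -h.
rewrite -(@ge0_integral_mscale _ _ _ _ _ _ (NngNum ci0))//.
by apply: eq_measure_integral => A mA _; exact: lebesgue_affine.
Qed.

End affine.

(** * Fubini's theorem in skew coordinates *)

Section skew.
Context {R : realType}.
Local Notation leb := (@lebesgue_measure R).
Local Notation RR := (measurableTypeR R * measurableTypeR R)%type.

Lemma measurable_skew :
  measurable_fun setT (fun z : RR => (z.1 - z.2, z.2) : RR).
Proof.
apply/measurable_fun_pairP; split => /=; last exact: measurable_snd.
by apply: measurable_funB; [exact: measurable_fst|exact: measurable_snd].
Qed.

Lemma integrable_skew (G : RR -> \bar R) :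
  (leb \x leb)%E.-integrable setT G ->
  (leb \x leb)%E.-integrable setT (fun z => G (z.1 - z.2, z.2)).
Proof.
move=> iG; have mG := measurable_int _ iG.
have mG' : measurable_fun setT (fun z : RR => G (z.1 - z.2, z.2)).
  exact: measurableT_comp mG measurable_skew.
apply/(integrable21ltyP _ _ mG').
have /(integrable21ltyP _ _ mG) := iG; apply: le_lt_trans.
rewrite le_eqVlt; apply/orP; left; apply/eqP; apply: eq_integral => r _ /=.
rewrite (@ge0_integral_preserving R (fun u => u - r) (fun u => `|G (u, r)|%E))//.
  exact: measure_preserving_shift.
apply: measurableT_comp => //.
exact: measurable_fun_pair1 mG.
Qed.

(** For each [r] the inner integrals agree by translation invariance; the order of
    integration has to be exchanged twice to make [r] the outer variable. *)
Lemma Fubini_skew (G : RR -> \bar R) :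
  (leb \x leb)%E.-integrable setT G ->
  (\int[leb]_u \int[leb]_r G (u - r, r)%R = \int[leb]_v \int[leb]_r G (v, r))%E.
Proof.
move=> iG; have iG' := integrable_skew iG.
have mG := measurable_int _ iG.
rewrite (Fubini iG) (Fubini iG').
apply: ae_eq_integral => //.
- exact: measurable_fubini_G iG'.
- exact: measurable_fubini_G iG.
move: (ae_integrable2 iG); apply: filterS => r iGr _ /=.
by rewrite (@integral_preserving R (fun u => u - r) (fun u => G (u, r)))//;
  exact: measure_preserving_shift.
Qed.

Lemma integrable_tensor (k h : R -> R) :
  leb.-integrable setT (EFin \o k) -> leb.-integrable setT (EFin \o h) ->
  (leb \x leb)%E.-integrable setT (fun z : RR => (k z.1 * h z.2)%:E).
Proof.
move=> ik ih.
have mk : measurable_fun setT k by apply/measurable_EFinP; exact: measurable_int ik.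
have mh : measurable_fun setT h by apply/measurable_EFinP; exact: measurable_int ih.
apply/integrable12ltyP.
  apply/measurable_EFinP; apply: measurable_funM.
    exact: measurableT_comp mk measurable_fst.
  exact: measurableT_comp mh measurable_snd.
have [_ fk] := integrableP _ _ _ ik; have [_ fh] := integrableP _ _ _ ih.
rewrite /= in fk fh.
have mnh : measurable_fun setT (fun x => `|h x|%:E).
  by apply/measurable_EFinP; exact: measurableT_comp.
have mnk : measurable_fun setT (fun x => `|k x|%:E).
  by apply/measurable_EFinP; exact: measurableT_comp.
apply: (@le_lt_trans _ _ (\int[leb]_x (`|k x|%:E * \int[leb]_y `|h y|%:E))%E).
  rewrite le_eqVlt; apply/orP; left; apply/eqP; apply: eq_integral => x _.
  rewrite -ge0_integralZl//; apply: eq_integral => y _.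
  by rewrite /= normrM EFinM.
rewrite ge0_integralZr//; last exact: integral_ge0.
by rewrite lte_mul_pinfty// ?integral_ge0// ge0_fin_numE// integral_ge0.
Qed.

End skew.

(** * Convolution and Laplace transform on the half line *)

Lemma integrable_scale d (T : measurableType d) (R : realType)
    (mu : {measure set T -> \bar R}) (D : set T) (f : T -> R) (c : R) :
  measurable D -> mu.-integrable D (EFin \o f) ->
  mu.-integrable D (fun x => (c * f x)%:E).
Proof. by move=> mD fi; have := integrableZl mD c fi. Qed.

Lemma integrable_add d (T : measurableType d) (R : realType)
    (mu : {measure set T -> \bar R}) (D : set T) (f g : T -> R) :
  measurable D -> mu.-integrable D (EFin \o f) -> mu.-integrable D (EFin \o g) ->
  mu.-integrable D (fun x => (f x + g x)%:E).
Proof. by move=> mD fi gi; have := integrableD mD fi gi. Qed.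

Section convolution.
Context {R : realType}.
Local Notation leb := (@lebesgue_measure R).
Local Notation RR := (measurableTypeR R * measurableTypeR R)%type.
Implicit Types (f g h k : R -> R) (s t u : R).

Lemma integrable_patch (D : set R) f : measurable D ->
  leb.-integrable D (EFin \o f) <-> leb.-integrable setT (EFin \o (f \_ D)).
Proof.
by move=> mD; rewrite -restrict_EFin; exact: integrable_mkcond.
Qed.

(** For [0 < u < t], cutting both factors at [t] does not change their convolution at [u]. *)
Lemma truncated_convol_support (x y t u r : R) : 0 < u -> u < t ->
  (if 0 < u - r < t then x else 0) * (if 0 < r < t then y else 0) * (u < t)%R%:R =
  if 0 < r < u then x * y else 0.
Proof.
by move=> u0 ut; do !case: ltP => ? /=; rewrite ?(mulr1, mulr0, mul0r)//;
  exfalso; lra.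
Qed.

Lemma truncated_convol_outside (x y t u r : R) : ~~ (0 < u < t) ->
  (if 0 < u - r < t then x else 0) * (if 0 < r < t then y else 0) * (u < t)%R%:R = 0.
Proof.
by do !case: ltP => ? //=; rewrite ?(mulr1, mulr0, mul0r)// => _; exfalso; lra.
Qed.

Lemma truncated_prim_support (x y t v r : R) : 0 < v -> v < t ->
  (if 0 < v < t then x else 0) * (if 0 < r < t then y else 0) * (v + r < t)%R%:R =
  if 0 < r < t - v then x * y else 0.
Proof.
by move=> v0 vt; do !case: ltP => ? /=; rewrite ?(mulr1, mulr0, mul0r)//;
  exfalso; lra.
Qed.

Definition prim f t := \int[leb]_(r in `]0, t[) f r.

Definition convol k h t := \int[leb]_(r in `]0, t[) (k (t - r) * h r).

Definition lap f s := \int[leb]_(t in `]0, +oo[) (expR (- (s * t)) * f t).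

Definition lap_integrable f s :=
  leb.-integrable `]0, +oo[ (fun t => (expR (- (s * t)) * f t)%:E).

(** Associativity of convolution, the function [1] being one of the three factors. Cutting
    [k] and [h] at [t] makes them integrable on the whole line, where the order of
    integration can be exchanged. *)
Lemma prim_convol k h t :
  leb.-integrable `]0, t[ (EFin \o k) -> leb.-integrable `]0, t[ (EFin \o h) ->
  (forall u, 0 < u < t ->
    leb.-integrable `]0, u[ (fun r => (k (u - r) * h r)%:E)) ->
  leb.-integrable `]0, t[ (EFin \o convol k h) /\
  prim (convol k h) t = \int[leb]_(v in `]0, t[) (k v * prim h (t - v)).
Proof.
move=> ik0 ih0 ikh.
pose kt := k \_ `]0, t[; pose ht := h \_ `]0, t[.
have ik : leb.-integrable setT (EFin \o kt) by apply/(integrable_patch _ (measurable_itv _)).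
have ih : leb.-integrable setT (EFin \o ht) by apply/(integrable_patch _ (measurable_itv _)).
(* in the coordinates [v] and [r] the condition [u < t] reads [v + r < t] *)
pose G := fun z : RR => (kt z.1 * ht z.2 * \1_`]-oo, t[ (z.1 + z.2))%:E.
have iG : (leb \x leb)%E.-integrable setT G.
  have := integrable_tensor ik ih; apply: le_integrable => //.
    apply/measurable_EFinP; apply: measurable_funM.
      have mT := measurable_int _ (integrable_tensor ik ih); move/measurable_EFinP : mT. exact.
    have ms : measurable_fun setT (fun z : RR => z.1 + z.2).
      by apply: measurable_funD; [exact: measurable_fst|exact: measurable_snd].
    have mI : measurable_fun setT (\1_`]-oo, t[ : R -> R) by apply: measurable_indic.
    exact: measurableT_comp mI ms.
  move=> z _; rewrite /G/= lee_fin normrM ler_piMr//.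
  by rewrite indicE; case: (_ \in _); rewrite ?normr1 ?normr0.
have := integrable_fubini_F (integrable_skew iG); rewrite /fubini_F/=.
have := Fubini_skew iG.
have -> : (fun u => \int[leb]_r G (u - r, r)%R)%E = EFin \o (convol k h \_ `]0, t[).
  apply/funext => u /=; rewrite patchE; case: ifPn => [|].
    rewrite inE/= in_itv/= => ut.
    rewrite /convol /Rintegral fineK; last exact: integrable_fin_num (ikh _ ut).
    rewrite [RHS]integral_mkcond; apply: eq_integral => r _.
    case/andP: ut => u0 ut.
    rewrite restrict_EFin /G/kt/ht/= subrK indicE !patchE !mem_setE !in_itv/=.
    by congr EFin; exact: truncated_convol_support.
  rewrite mem_setE in_itv/= => ut; rewrite integral0_eq// => r _.
  rewrite /G/kt/ht/= subrK indicE !patchE !mem_setE !in_itv/=.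
  by congr EFin; exact: truncated_convol_outside.
have -> : (fun v => \int[leb]_r G (v, r)%R)%E =
    EFin \o ((fun v => k v * prim h (t - v)) \_ `]0, t[).
  apply/funext => v /=; rewrite patchE; case: ifPn => [|].
    rewrite inE/= in_itv/= => /andP[v0 vt].
    have ihv : leb.-integrable `]0, t - v[ (EFin \o h).
      apply: integrableS ih0 => //; apply: subset_itvl; rewrite bnd_simp; lra.
    rewrite /prim -RintegralZl// /Rintegral fineK; last first.
      by apply: integrable_fin_num => //; exact: integrable_scale.
    rewrite [RHS]integral_mkcond; apply: eq_integral => r _.
    rewrite restrict_EFin /G/kt/ht/= indicE !patchE !mem_setE !in_itv/=.
    by congr EFin; exact: truncated_prim_support.
  move=> vt; rewrite integral0_eq// => r _.
  by rewrite /G/kt/= patchE (negbTE vt) !mul0r.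
move=> E1 I1.
split; first by apply/(integrable_patch _ (measurable_itv _)).
by rewrite /prim Rintegral_mkcond [RHS]Rintegral_mkcond /Rintegral; congr fine.
Qed.

(** The factor [expR (- s * u)] splits as a product over [u = (u - r) + r], which turns
    the transform of a convolution into the integral of a convolution. *)
Lemma lap_convol k h s : lap_integrable k s -> lap_integrable h s ->
  (forall u, 0 < u ->
    leb.-integrable `]0, u[ (fun r => (k (u - r) * h r)%:E)) ->
  lap_integrable (convol k h) s /\ lap (convol k h) s = lap k s * lap h s.
Proof.
move=> ik0 ih0 ikh.
pose e f := fun t => expR (- (s * t)) * f t.
pose kt := e k \_ `]0, +oo[; pose ht := e h \_ `]0, +oo[.
have ik : leb.-integrable setT (EFin \o kt) by apply/(integrable_patch _ (measurable_itv _)).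
have ih : leb.-integrable setT (EFin \o ht) by apply/(integrable_patch _ (measurable_itv _)).
pose G := fun z : RR => (kt z.1 * ht z.2)%:E.
have iG : (leb \x leb)%E.-integrable setT G by exact: integrable_tensor.
have := integrable_fubini_F (integrable_skew iG); rewrite /fubini_F/=.
have := Fubini_skew iG.
have -> : (fun u => \int[leb]_r G (u - r, r)%R)%E =
    EFin \o (e (convol k h) \_ `]0, +oo[).
  apply/funext => u /=; rewrite patchE; case: ifPn => [|].
    rewrite inE/= in_itv/= andbT => u0.
    rewrite /e /convol -RintegralZl//; last exact: ikh.
    rewrite /Rintegral fineK; last first.
      apply: integrable_fin_num => //.
      by apply: integrable_scale => //; exact: ikh.
    rewrite [RHS]integral_mkcond; apply: eq_integral => r _.
    rewrite restrict_EFin /G/kt/ht/= !patchE !mem_setE !in_itv/= !andbT.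
    do !case: ltP => ? /=; rewrite ?(mulr0, mul0r)//; try by exfalso; lra.
    congr EFin; rewrite /e mulrACA -expRD; congr (expR _ * _).
    by ring.
  rewrite mem_setE in_itv/= andbT => ut; rewrite integral0_eq// => r _; move: ut.
  rewrite /G/kt/ht/= !patchE !mem_setE !in_itv/= !andbT.
  by do !case: ltP => ? //=; rewrite ?(mulr0, mul0r)// => _; exfalso; lra.
have -> : (fun v => \int[leb]_r G (v, r)%R)%E = (fun v => (kt v * lap h s)%:E).
  apply/funext => v /=; rewrite /G/= /lap Rintegral_mkcond -RintegralZl//.
  rewrite /Rintegral fineK//; apply: integrable_fin_num => //.
  exact: integrable_scale.
move=> E1 I1.
split; first by apply/(integrable_patch _ (measurable_itv _)).
rewrite /lap Rintegral_mkcond [in RHS]Rintegral_mkcond -RintegralZr//.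
by rewrite /Rintegral; congr fine.
Qed.

End convolution.

(** * Integrability of exponentials and powers *)

Section kernels.
Context {R : realType}.
Local Notation leb := (@lebesgue_measure R).
Implicit Types (f g h k : R -> R) (s t u p : R).

Lemma lap_cst1 s : 0 < s ->
  lap_integrable (cst 1) s /\ lap (cst 1) s = s^-1.
Proof.
move=> s0.
have E : (fun t : R => expR (- (s * t)) * 1) \_ `]0, +oo[ =
    (fun t => s^-1 * (exponential_pdf s \_ `]0, +oo[) t).
  apply/funext => x; rewrite !patchE; case: ifPn; rewrite ?mulr0//.
  rewrite inE/= in_itv/= andbT => x0.
  rewrite exponential_pdfE ?ltW///=.
  by rewrite mulrA mulVf ?gt_eqF// mul1r mulr1 mulNr.
have i1 : leb.-integrable `]0, +oo[ (EFin \o exponential_pdf s).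
  exact: integrableS (integrable_exponential_pdf s0).
have i0 : leb.-integrable `]0, +oo[ (fun t : R => (expR (- (s * t)) * 1)%:E).
  apply/(integrable_patch _ (measurable_itv _)); rewrite E.
  apply: integrable_scale => //.
  by apply/(integrable_patch _ (measurable_itv _)).
split => //.
rewrite /lap Rintegral_mkcond/= E RintegralZl//; last first.
  by apply/(integrable_patch _ (measurable_itv _)).
rewrite -Rintegral_mkcond Rintegral_itv_obnd_cbnd//.
rewrite Rintegral_mkcond/= -[RHS]mulr1; congr (_ * _).
rewrite /Rintegral -[RHS]/(fine 1%E) -(integral_exponential_pdf s0); congr fine.
apply: eq_integral => x _; rewrite patchE; case: ifPn => //.
rewrite mem_setE in_itv/= andbT -ltNge => x0.
by rewrite lt0_exponential_pdf.
Qed.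

Lemma integrable_le (D : set R) f g : measurable D ->
  measurable_fun D f -> leb.-integrable D (EFin \o g) ->
  (forall x, D x -> `|f x| <= g x) -> leb.-integrable D (EFin \o f).
Proof.
move=> mD mf ig fg; apply: le_integrable ig => //; first exact/measurable_EFinP.
by move=> x Dx; rewrite /= lee_fin (le_trans (fg _ Dx))// ler_norm.
Qed.

Lemma measurable_expsM D s : measurable_fun D (fun t : R => expR (- (s * t))).
Proof.
apply: measurable_funTS; apply: measurableT_comp; first exact: measurable_expR.
by apply: measurable_funN; exact: measurable_funM.
Qed.

Lemma bounded_lap_integrable f s (C : R) : 0 < s ->
  measurable_fun (`]0, +oo[ : set R) f -> (forall t, 0 < t -> `|f t| <= C) ->
  lap_integrable f s.
Proof.
move=> s0 mf fC; have [i1 _] := lap_cst1 s0.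
apply: (@integrable_le _ _ (fun t => C * (expR (- (s * t)) * 1))) => //.
- by apply: measurable_funM => //; exact: measurable_expsM.
- exact: integrable_scale.
- move=> t /=; rewrite in_itv/= andbT => t0.
  by rewrite normrM ger0_norm ?expR_ge0// mulr1 mulrC ler_wpM2r ?expR_ge0// fC.
Qed.

(** The primitive [t `^ p / p] is bounded near the origin, so the integrals over the
    intervals from [1 / (n + 1)] to [1] stay below [1 / p]; they exhaust the half-open interval. *)
Lemma integrable_powR01 p : 0 < p ->
  leb.-integrable `]0, 1] (fun t => (t `^ (p - 1))%:E).
Proof.
move=> p0; apply/integrableP; split.
  by apply/measurable_EFinP/measurable_funTS; exact: measurable_powR.
under eq_integral do rewrite /= ger0_norm ?powR_ge0//.
pose F (n : nat) := `[n.+1%:R^-1 : R, 1]%classic.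
have UF : `]0, 1]%classic = \bigcup_n F n.
  apply/seteqP; split => x /=; rewrite in_itv/=.
    move=> /andP[x0 x1]; have [n nx] := ltr_add_invr x0.
    by exists n => //=; rewrite /F/= in_itv/= x1 andbT -[X in X <= _]add0r ltW.
  move=> [n _]; rewrite /F/= in_itv/= => /andP[nx ->]; rewrite andbT.
  by rewrite (lt_le_trans _ nx).
have := @ge0_nondecreasing_set_cvg_integral _ (measurableTypeR R) R F
  (fun t => (t `^ (p - 1))%:E) leb.
rewrite -UF => cv.
have h : (\int[leb]_(x in `]0%R, 1%R]) (x `^ (p - 1))%:E <= (p^-1)%:E)%E.
  apply: (cvge_to_le (cv _ _ _ _)).
  - move=> m n mn; rewrite subsetEset; apply: subset_itvr; rewrite bnd_simp.
    by rewrite lef_pV2 ?posrE// ler_nat.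
  - by move=> n; exact: measurable_itv.
  - by move=> n; apply/measurable_EFinP/measurable_funTS; exact: measurable_powR.
  - by move=> n x _; rewrite lee_fin powR_ge0.
  apply: nearW => n.
  have [->|n0] := eqVneq n 0%N.
    rewrite /F invr1 set_itv1 integral_set1 lee_fin invr_ge0 ltW//.
  have n1 : n.+1%:R^-1 < 1 :> R by rewrite invf_lt1// ltr1n ltnS lt0n.
  have n1p : 0 < n.+1%:R^-1 :> R by rewrite invr_gt0.
  have dF (x : R) : 0 < x -> derivable (fun t : R => p^-1 * t `^ p) x 1.
    move=> x0; apply: derivableM => //; apply: derivable_powR.
    by rewrite in_itv/= x0.
  have cF (x : R) : 0 < x -> {for x, continuous (fun t : R => p^-1 * t `^ p)}.
    move=> x0; apply: differentiable_continuous; apply/derivable1_diffP.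
    exact: dF.
  rewrite (@continuous_FTC2 _ _ (fun t => p^-1 * t `^ p))//.
  - rewrite -EFinB lee_fin powR1 mulr1 gerBl mulr_ge0 ?powR_ge0// invr_ge0 ltW//.
  - apply: continuous_in_subspaceT => x; rewrite inE/= in_itv/= => /andP[nx _].
    apply: differentiable_continuous; apply/derivable1_diffP.
    by apply: derivable_powR; rewrite in_itv/= andbT (lt_le_trans _ nx).
  - split.
    + move=> x; rewrite in_itv/= => /andP[nx _]; apply: dF.
      exact: lt_trans nx.
    + by apply: cvg_at_right_filter; exact: cF.
    + by apply: cvg_at_left_filter; exact: cF.
  - move=> x; rewrite in_itv/= => /andP[nx _].
    have x0 : 0 < x by exact: lt_trans nx.
    rewrite derive1E deriveM//=; last first.
      by apply: derivable_powR; rewrite in_itv/= x0.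
    rewrite derive_cst scaler0 addr0 -derive1E powR_derive1 ?in_itv/= ?x0//.
    by rewrite /GRing.scale/= mulrA mulVf ?mul1r// gt_eqF.
exact: le_lt_trans h (ltry _).
Qed.

End kernels.

(** * The Gamma integral and the Laplace transform of a power *)

Section gamma.
Context {R : realType}.
Local Notation leb := (@lebesgue_measure R).
Implicit Types (f g h k : R -> R) (s t u p : R).

(** The integrand is at most [t `^ (p - 1)] up to [1] and at most [expR (- t)] beyond. *)
Lemma integrable_gamma p : 0 < p <= 1 ->
  leb.-integrable `]0, +oo[ (fun t => (t `^ (p - 1) * expR (- t))%:E).
Proof.
move=> /andP[p0 p1].
have [i1 _] := @lap_cst1 R 1 ltr01.
apply: (@integrable_le _ _ _ (fun t => ((fun t => t `^ (p - 1)) \_ `]0, 1]) t +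
  expR (- (1 * t)) * 1)) => //.
- apply: measurable_funTS; apply: measurable_funM; first exact: measurable_powR.
  by apply: measurableT_comp; [exact: measurable_expR|exact: oppr_measurable].
- have i0 : leb.-integrable `]0, +oo[
      (EFin \o ((fun t : R => t `^ (p - 1)) \_ `]0, 1])).
    apply: (@integrableS _ _ _ _ setT) => //.
    by apply/(integrable_patch _ (measurable_itv _)); exact: integrable_powR01.
  exact: integrable_add.
- move=> t /=; rewrite in_itv/= andbT => t0.
  rewrite ger0_norm ?mulr_ge0 ?powR_ge0 ?expR_ge0//.
  rewrite patchE mem_setE in_itv/= t0/= mul1r mulr1; case: (leP t 1) => t1.
    rewrite -[leLHS]addr0 lerD ?expR_ge0// ler_piMr ?powR_ge0//.
    by rewrite expR_le1 oppr_le0 ltW.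
  rewrite add0r ler_piMl ?expR_ge0//.
  rewrite -[leRHS](powRr0 t); apply: ler_powR; first exact: ltW.
  by rewrite subr_le0.
Qed.

(** On the unit interval the integrand is at least [expR (- 1)]. *)
Lemma Gamma_gt0 p : 0 < p <= 1 -> 0 < Gamma p.
Proof.
move=> pp; have ig := integrable_gamma pp; case/andP: pp => p0 p1.
apply: (@lt_le_trans _ _ (expR (- 1))); first exact: expR_gt0.
have -> : expR (- 1) = \int[leb]_(t in `]0, 1]) expR (- 1) :> R.
  by rewrite Rintegral_cst//= lebesgue_measure_itv/= lte_fin ltr01 oppr0 addr0 mulr1.
have sub : `]0%R, 1%R] `<=` (`]0%R, +oo[%classic : set R).
  by apply: subset_itvl.
apply: (@le_trans _ _ (\int[leb]_(t in `]0, 1]) (t `^ (p - 1) * expR (- t)))).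
  apply: le_Rintegral => //.
  - apply: measurable_bounded_integrable => //=.
      by rewrite lebesgue_measure_itv/= lte_fin ltr01 -EFinB ltry.
    exact: bounded_cst.
  - exact: integrableS ig.
  - move=> t /=; rewrite in_itv/= => /andP[t0 t1].
    rewrite -[leLHS]mul1r ler_pM ?expR_ge0// ?ler_expR ?lerN2//.
    rewrite -[leLHS](powRr0 t); apply: ger_powR; first by rewrite t0.
    by rewrite subr_le0.
rewrite /Gamma /Rintegral fine_le//.
- by apply: integrable_fin_num => //; exact: integrableS ig.
- exact: integrable_fin_num.
apply: ge0_subset_integral => //.
- by have /integrableP[] := ig.
- by move=> t _; rewrite lee_fin mulr_ge0 ?powR_ge0 ?expR_ge0.
Qed.

(** The substitution [t := s * t] in the Gamma integral. *)
Lemma lap_powR p s : 0 < p <= 1 -> 0 < s ->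
  lap_integrable (fun t => t `^ (p - 1)) s /\
  lap (fun t => t `^ (p - 1)) s = Gamma p * s `^ (- p).
Proof.
move=> pp s0; have ig := integrable_gamma pp; case/andP: pp => p0 p1.
pose f := (fun t : R => t `^ (p - 1) * expR (- t)) \_ `]0, +oo[.
have iF : leb.-integrable setT (EFin \o f).
  by apply/(integrable_patch _ (measurable_itv _)).
have f0 x : 0 <= f x.
  by rewrite /f patchE; case: ifPn => // _; rewrite mulr_ge0 ?powR_ge0 ?expR_ge0.
have E : (fun t : R => expR (- (s * t)) * t `^ (p - 1)) \_ `]0, +oo[ =
    (fun t => s `^ (1 - p) * f (s * t)).
  apply/funext => t; rewrite /f !patchE !mem_setE !in_itv/= !andbT pmulr_rgt0//.
  case: ifPn => t0; last by rewrite mulr0.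
  rewrite powRM ?(ltW s0) ?(ltW t0)// mulrA mulrA -powRD; last first.
    by rewrite (gt_eqF s0) implybT.
  by rewrite addrA subrK subrr powRr0 mul1r mulrC.
have mfs : measurable_fun setT (fun t => (f (s * t))%:E).
  have h : measurable_fun setT f.
    by apply/measurable_EFinP; case/integrableP: iF.
  apply/measurable_EFinP; apply: measurableT_comp h _.
  exact: measurable_funM.
have ES : (\int[leb]_t (f (s * t))%:E = s^-1%:E * \int[leb]_t (f t)%:E)%E.
  rewrite (@ge0_integral_scale R s (EFin \o f) s0)//.
  by case/integrableP: iF.
have ifs : leb.-integrable setT (fun t => (f (s * t))%:E).
  apply/integrableP; split=> //.
  under eq_integral do rewrite gee0_abs ?lee_fin//.
  rewrite ES lte_mul_pinfty// ?lee_fin ?invr_ge0 ?(ltW s0)//.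
  have /integrableP[_] := iF.
  by under eq_integral do rewrite gee0_abs ?lee_fin//.
split.
  apply/(integrable_patch _ (measurable_itv _)); rewrite E.
  exact: integrable_scale.
rewrite /lap Rintegral_mkcond/= E RintegralZl// {1}/Rintegral ES fineM//=; last first.
  exact: integrable_fin_num.
rewrite /Gamma Rintegral_mkcond -/f mulrA mulrC; congr (_ * _).
rewrite -powR_inv1 ?(ltW s0)// -powRD; last by rewrite (gt_eqF s0) implybT.
by congr (_ `^ _); ring.
Qed.

Lemma integrable_powR p t : 0 < p <= 1 ->
  leb.-integrable `]0, t[ (fun r => (r `^ (p - 1))%:E).
Proof.
move=> pp; have ig := integrable_gamma pp.
have sub : `]0%R, t[ `<=` (`]0%R, +oo[%classic : set R) by exact: subset_itvl.
apply: (@integrable_le _ _ _ (fun r => expR t * (r `^ (p - 1) * expR (- r)))) => //.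
- by apply: measurable_funTS; exact: measurable_powR.
- by apply: integrable_scale => //; exact: integrableS ig.
move=> r /=; rewrite in_itv/= => /andP[r0 rt].
rewrite ger0_norm ?powR_ge0// mulrCA -expRD ler_peMr ?powR_ge0//.
by rewrite -expR0 ler_expR subr_ge0 ltW.
Qed.

Lemma Rintegral_reflect t f : leb.-integrable `]0, t[ (EFin \o f) ->
  leb.-integrable `]0, t[ (fun r => (f (t - r))%:E) /\
  \int[leb]_(r in `]0, t[) f (t - r) = \int[leb]_(r in `]0, t[) f r.
Proof.
move=> itf.
have itf' : leb.-integrable setT (EFin \o (f \_ `]0, t[)).
  by apply/(integrable_patch _ (measurable_itv _)).
have E : (fun r => f (t - r)) \_ `]0, t[ = fun r => (f \_ `]0, t[) (t - r).
  apply/funext => r; rewrite !patchE !mem_setE !in_itv/=.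
  by do !case: ltP => ? //=; exfalso; lra.
split.
  apply/(integrable_patch _ (measurable_itv _)); rewrite E.
  exact: (integrable_preserving (measure_preserving_reflect t) itf').
rewrite Rintegral_mkcond/= E [RHS]Rintegral_mkcond/= /Rintegral; congr fine.
exact: (integral_preserving (measure_preserving_reflect t) itf').
Qed.

Lemma integrableMr_bounded (D : set R) k h (C : R) : measurable D ->
  leb.-integrable D (EFin \o k) -> measurable_fun D h ->
  (forall r, D r -> `|h r| <= C) ->
  leb.-integrable D (fun r => (k r * h r)%:E).
Proof.
move=> mD ik mh hC.
apply: (@integrable_le _ _ _ (fun r => C * `|k r|)) => //.
- by apply: measurable_funM => //; apply/measurable_EFinP; case/integrableP : ik.
- by apply: integrable_scale => //; exact: integrable_norm ik.
- by move=> r Dr; rewrite normrM mulrC ler_wpM2r// hC.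
Qed.

End gamma.

(** * Local absolute continuity *)

Section local_absolute_continuity.
Context {R : realType}.
Local Notation leb := (@lebesgue_measure R).
Implicit Types (f g h k : R -> R) (s t u b : R).

Lemma loc_abs_cont_continuous g : loc_abs_cont g ->
  forall t, 0 < t -> {for t, continuous g}.
Proof.
move=> ag t t0; pose a := t / 2; pose b := t + 1.
have a0 : 0 < a by rewrite /a; lra.
have ab : a < b by rewrite /a /b; lra.
have [ig _] := ag a b a0 (ltW ab).
have igab : leb.-integrable `[a, b] (EFin \o g^`()).
  by apply: integrableS ig => //; apply: subset_itvr; rewrite bnd_simp.
have := parameterized_integral_continuous (ltW ab) igab.
move/(continuous_within_itvP _ ab) => -[+ _ _] => /(_ t).
have tab : t \in `]a, b[%R by rewrite in_itv/= /a /b; apply/andP; split; lra.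
move=> /(_ tab) ct.
have E : {near t, (fun x => g a + parameterized_integral leb a x g^`()) =1 g}.
  near=> x.
  have ax : a <= x by apply: ltW; near: x; apply: lt_nbhsr; rewrite /a; lra.
  have xb : x <= b by apply: ltW; near: x; apply: lt_nbhsl; rewrite /b; lra.
  have [_ gg] := ag a x a0 ax.
  rewrite /= -[RHS](subrKC (g a)) gg.
  rewrite /parameterized_integral -Rintegral_itv_obnd_cbnd//.
  by apply: (integrableS _ _ _ igab) => //; apply: subset_itv; rewrite bnd_simp.
apply: (cvg_trans (near_eq_cvg E)).
rewrite /prop_for /continuous_at -(nbhs_singleton E).
by apply: cvgD; [exact: cvg_cst|exact: ct].
Unshelve. all: by end_near. Qed.

(** Local absolute continuity holds on the open half line only; the limit [l] at the
    origin supplies the initial value. *)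
Lemma prim_derive1 g (l : R) : loc_abs_cont g -> g x @[x --> 0^'+] --> l ->
  forall t, 0 < t ->
  leb.-integrable `]0, t[ (EFin \o g^`()) /\ prim g^`() t = g t - l.
Proof.
move=> ag gl t t0.
have [ig _] := ag t t t0 (lexx t).
have igo : leb.-integrable `]0, t[ (EFin \o g^`()).
  by apply: integrableS ig => //; apply: subset_itvl; rewrite bnd_simp.
split => //; rewrite /prim Rintegral_itv_bndo_bndc//.
pose h := g^`() \_ `]0, t].
have ih : leb.-integrable setT (EFin \o h).
  by apply/(integrable_patch _ (measurable_itv _)).
have ihc (A : set R) : measurable A -> leb.-integrable A (EFin \o h).
  by move=> mA; exact: integrableS ih.
have cv : parameterized_integral leb 0 x h @[x --> 0^'+] --> 0.
  apply: cvg_at_right_filter.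
  rewrite -[X in _ --> X](_ : parameterized_integral leb 0 0 h = 0); last first.
    by rewrite /parameterized_integral set_itv1 Rintegral_set1.
  rewrite [X in _ --> X](_ : _ = 0); last first.
    by rewrite /parameterized_integral set_itv1 Rintegral_set1.
  by apply: (@parameterized_integral_cvg_left R 0 t) => //; exact: ihc.
have cv1 : g x + (\int[leb]_(r in `]0, t]) derive1 g r -
    parameterized_integral leb 0 x h) @[x --> 0^'+] -->
    l + (\int[leb]_(r in `]0, t]) derive1 g r - 0).
  by apply: cvgD => //; apply: cvgB => //; exact: cvg_cst.
have cv2 : g x + (\int[leb]_(r in `]0, t]) derive1 g r -
    parameterized_integral leb 0 x h) @[x --> 0^'+] --> g t.
  apply: cvg_near_cst; near=> x.
  have x0 : 0 < x by near: x; exact: nbhs_right_gt.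
  have xt : x <= t by near: x; exact: nbhs_right_le.
  have [_ gg] := ag x t x0 xt.
  rewrite -(subrKC (g x) (g t)) gg; congr (_ + _).
  rewrite /parameterized_integral -Rintegral_itv_obnd_cbnd; last exact: ihc.
  rewrite -[RHS](@Rintegral_itvB _ _ (BRight 0) _ x ig) ?bnd_simp//.
  congr (_ - _); apply: eq_Rintegral => r; rewrite inE/= in_itv/= => /andP[r0 rx].
  by rewrite /h patchE mem_set//= in_itv/= r0 (le_trans rx).
have := cvg_unique (@Rhausdorff R) cv1 cv2; rewrite subr0 => <-.
by rewrite addrAC subrr add0r.
Unshelve. all: by end_near. Qed.

End local_absolute_continuity.

(** * Laplace transform of the Caputo derivative *)

Section caputo_laplace.
Context {R : realType}.
Local Notation leb := (@lebesgue_measure R).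
Local Notation pos := (`]0%R, +oo[%classic : set R).
Implicit Types (f g h k F : R -> R) (s t u b : R).

Lemma eq_prim f g t : (forall r, 0 < r -> f r = g r) -> prim f t = prim g t.
Proof.
move=> fg; apply: eq_Rintegral => r; rewrite inE/= in_itv/= => /andP[r0 _].
exact: fg.
Qed.

Lemma eq_lap f g s : (forall t, 0 < t -> f t = g t) -> lap f s = lap g s.
Proof.
move=> fg; apply: eq_Rintegral => t; rewrite inE/= in_itv/= andbT => t0.
by rewrite fg.
Qed.

Lemma eq_lap_integrable f g s : (forall t, 0 < t -> f t = g t) ->
  lap_integrable f s -> lap_integrable g s.
Proof.
move=> fg; apply: eq_integrable => // t; rewrite inE/= in_itv/= andbT => t0.
by rewrite fg.
Qed.

Lemma lapZ f c s : lap_integrable f s ->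
  lap_integrable (fun t => c * f t) s /\ lap (fun t => c * f t) s = c * lap f s.
Proof.
move=> fs.
have E : (fun t => expR (- (s * t)) * (c * f t)) =
    (fun t => c * (expR (- (s * t)) * f t)) by apply/funext => t; ring.
rewrite /lap_integrable /lap -RintegralZl// E; split => //.
  by rewrite (_ : (fun t : R => _) =
    (fun t => (c * (expR (- (s * t)) * f t))%:E)); [exact: integrable_scale|
    apply/funext => t; congr EFin; ring].
Qed.

Lemma lapD f g s : lap_integrable f s -> lap_integrable g s ->
  lap_integrable (fun t => f t + g t) s /\
  lap (fun t => f t + g t) s = lap f s + lap g s.
Proof.
move=> fs gs.
have E : (fun t => expR (- (s * t)) * (f t + g t)) =
    (fun t => expR (- (s * t)) * f t + expR (- (s * t)) * g t).
  by apply/funext => t; ring.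
rewrite /lap_integrable /lap -RintegralD// E; split => //.
rewrite (_ : (fun t : R => _) =
    (fun t => (expR (- (s * t)) * f t + expR (- (s * t)) * g t)%:E)).
  exact: integrable_add.
by apply/funext => t; congr EFin; ring.
Qed.

Lemma lap_integrable_itv f s u : 0 < s -> lap_integrable f s ->
  leb.-integrable `]0, u[ (EFin \o f).
Proof.
move=> s0 fs.
have sub : `]0%R, u[ `<=` pos by exact: subset_itvl.
have i1 : leb.-integrable `]0, u[ (EFin \o (fun t => expR (- (s * t)) * f t)).
  exact: integrableS fs.
have mE : measurable_fun `]0, u[ (fun t : R => expR (s * t)).
  apply: measurable_funTS; apply: measurableT_comp; first exact: measurable_expR.
  exact: measurable_funM.
rewrite (_ : _ \o f = (fun r => (expR (- (s * r)) * f r * expR (s * r))%:E)).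
  apply: (integrableMr_bounded _ i1 mE (C := expR (s * u))) => //.
  move=> r /=; rewrite in_itv/= => /andP[r0 ru].
  by rewrite ger0_norm ?expR_ge0// ler_expR ler_pM2l// ltW.
apply/funext => r /=; congr EFin.
by rewrite mulrAC -expRD addrC subrr expR0 mul1r.
Qed.

(** The primitive is the convolution with the constant [1], whose transform is [1 / s]. *)
Lemma lap_prim g s : 0 < s -> lap_integrable g s ->
  lap_integrable (prim g) s /\ lap (prim g) s = s^-1 * lap g s.
Proof.
move=> s0 ig; have [i1 <-] := lap_cst1 s0.
have <- : convol (cst 1) g = prim g.
  by apply/funext => t; apply: eq_Rintegral => r _; rewrite mul1r.
apply: lap_convol => // u u0; have := lap_integrable_itv u s0 ig.
by congr (_.-integrable _ _); apply/funext => r; rewrite /= mul1r.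
Qed.

Lemma measurable_reflect F u : measurable_fun pos F ->
  measurable_fun (`]0%R, u[%classic : set R) (fun r => F (u - r)).
Proof.
move=> mF; apply: (measurable_comp (F := pos)) => //.
- move=> x [r] /=; rewrite in_itv/= => /andP[r0 ru] <-; rewrite in_itv/= andbT.
  by rewrite subr_gt0.
- by apply: measurable_funTS; apply: measurable_funB.
Qed.

Lemma lap_bounded_convol F k s (C : R) : 0 < s ->
  measurable_fun pos F -> (forall t, 0 < t -> `|F t| <= C) ->
  lap_integrable k s ->
  lap (convol F k) s = lap F s * lap k s.
Proof.
move=> s0 mF FC ik.
have iF := bounded_lap_integrable s0 mF FC.
have [|_ ->] := lap_convol iF ik; last by [].
move=> u u0; have iku := lap_integrable_itv u s0 ik.
rewrite (_ : (fun r => _) = (fun r => (k r * F (u - r))%:E)); last first.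
  by apply/funext => r; rewrite mulrC.
apply: (integrableMr_bounded _ iku (measurable_reflect mF) (C := C)) => //.
move=> r /=; rewrite in_itv/= => /andP[r0 ru]; apply: FC.
by rewrite subr_gt0.
Qed.

(** Associativity moves the primitive onto the derivative [g'], which integrates to
    [g - l]. *)
Lemma prim_convol_derive1 g k t (l : R) : loc_abs_cont g ->
  g x @[x --> 0^'+] --> l -> (forall t, 0 < t ->
    leb.-integrable `]0, t[ (EFin \o k)) ->
  (forall u, 0 < u -> leb.-integrable `]0, u[ (fun r => (k (u - r) * derive1 g r)%:E)) ->
  0 < t -> prim (convol k (derive1 g)) t = convol (fun x => g x - l) k t.
Proof.
move=> ag gl ik ikg t0.
have [ig _] := prim_derive1 ag gl t0.
have [|_ ->] := prim_convol (ik _ t0) ig.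
  by move=> u /andP[u0 _]; exact: ikg.
apply: eq_Rintegral => r; rewrite inE/= in_itv/= => /andP[r0 rt].
have tr0 : 0 < t - r by rewrite subr_gt0.
by have [_ ->] := prim_derive1 ag gl tr0; rewrite mulrC.
Qed.

Lemma caputo_degree1 b : 0 < b <= 1 -> caputo_degree b = 1%N.
Proof.
move=> /andP[b0 b1]; rewrite /caputo_degree (_ : Num.ceil b = 1)//.
apply/eqP; rewrite eq_le -[X in _ && X]/(0 < Num.ceil b)%R.
by rewrite ceil_le_int b1 ceil_gt0.
Qed.

Lemma caputo_degree2 b : 1 < b <= 2 -> caputo_degree b = 2%N.
Proof.
move=> /andP[b0 b1]; rewrite /caputo_degree (_ : Num.ceil b = 2)//.
apply/eqP; rewrite eq_le -[X in _ && X]/(1 < Num.ceil b)%R.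
by rewrite ceil_le_int b1 ceil_gt_int.
Qed.

Lemma caputo_measurable f b : caputo_derivable b f -> 0 < b ->
  measurable_fun pos f.
Proof.
move=> [_ af _] b0; apply: open_continuous_measurable_fun; first exact: interval_open.
move=> x; rewrite inE/= in_itv/= andbT => x0.
apply: (@loc_abs_cont_continuous R f) => //; apply: (af 0%N).
by rewrite /caputo_degree absz_gt0 ceil_neq0 b0 orbT.
Qed.

(** With [m] the degree of [b], the [m]-fold primitive of the Caputo derivative is the
    convolution of [f - f 0] with [t `^ (m - b - 1) / Gamma (m - b)], or [f - f 0] itself if
    [b = m]. Only the bounded functions [f] and [caputo b f] enter this identity, so it can be
    transformed although the derivatives of [f] may have no transform. The condition at the
    origin makes the first derivative vanish there when [m = 2]. *)
Lemma lap_caputo b f s (C C' : R) : 0 < b <= 2 -> 0 < s ->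
  caputo_derivable b f -> (1 < b -> (derive1 f) t @[t --> 0^'+] --> (0 : R)) ->
  (forall t, 0 < t -> `|f t| <= C) ->
  measurable_fun pos (caputo b f) -> (forall t, 0 < t -> `|caputo b f t| <= C') ->
  lap (caputo b f) s = s `^ b * (lap f s - f 0 / s).
Proof.
move=> /andP[b0 b2] s0 Df f'0 fC mG GC.
have mf := caputo_measurable Df b0.
have ifs := bounded_lap_integrable s0 mf fC.
have iG := bounded_lap_integrable s0 mG GC.
have [i1 l1] := lap_cst1 s0.
have [iN lN] := lapZ (- f 0) i1.
have [iF lF] := lapD ifs iN.
have {}lF : lap (fun x => f x - f 0) s = lap f s - f 0 / s.
  rewrite -mulNr -l1 -lN -lF; apply: eq_lap => t t0; by rewrite mulr1.
have {iN i1 l1 lN}iF : lap_integrable (fun x => f x - f 0) s.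
  by apply: eq_lap_integrable iF => t _; rewrite mulr1.
rewrite -lF.
have FC t : 0 < t -> `|f t - f 0| <= C + `|f 0|.
  by move=> t0; rewrite (le_trans (ler_normB _ _))// lerD2r fC.
have mF : measurable_fun pos (fun t => f t - f 0) by exact: measurable_funB.
have [f0 + +] := Df.
have [iPG lPG] := lap_prim s0 iG.
have [b1|b1] := leP b 1.
  (* degree 1: one integration *)
  rewrite caputo_degree1 ?b0//= => /(_ 0%N isT) /= af.
  have {}DF t : 0 < t -> leb.-integrable `]0, t[ (EFin \o (derive1 f)) /\
      prim (derive1 f) t = f t - f 0 by exact: prim_derive1.
  have [b1e _|b1n dG] := eqVneq b 1%:R.
    rewrite b1e powRr1 ?ltW//.
    rewrite (_ : lap (caputo 1%:R f) s = s * (s^-1 * lap (caputo b f) s)); last first.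
      by rewrite b1e mulrA (mulfV (lt0r_neq0 s0)) mul1r.
    rewrite -lPG; congr (_ * _); apply: eq_lap => t t0.
    have [_ <-] := DF t t0; apply: eq_prim => r r0.
    by rewrite /caputo caputo_degree1 ?b0//= b1e eqxx.
  have p01 : 0 < 1 - b <= 1 by apply/andP; split; [rewrite subr_gt0 lt_neqAle b1n|lra].
  have [ik lk] := lap_powR p01 s0.
  have GE t : 0 < t -> convol (fun r => r `^ (1 - b - 1)) (derive1 f) t =
      Gamma (1 - b) * caputo b f t.
    move=> t0; rewrite /caputo caputo_degree1 ?b0//= (negbTE b1n) mulrA divff ?mul1r//.
    by rewrite gt_eqF// Gamma_gt0.
  have [iPG' _] := lapZ (Gamma (1 - b)) iPG.
  have E t : 0 < t -> Gamma (1 - b) * prim (caputo b f) t =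
      convol (fun x => f x - f 0) (fun r => r `^ (1 - b - 1)) t.
    move=> t0; rewrite -(prim_convol_derive1 af f0)//; last first.
      by move=> u _; exact: integrable_powR.
    rewrite (eq_prim _ GE) /prim RintegralZl//.
    exact: lap_integrable_itv iG.
  have := lap_bounded_convol s0 mF FC ik.
  rewrite -(eq_lap _ E); have [_ ->] := lapZ (Gamma (1 - b)) iPG.
  rewrite lPG lk.
  set LG := lap (caputo b f) s; set LF := lap _ s => h.
  have {}h : LG = s * (LF * s `^ (- (1 - b))).
    have g0 : Gamma (1 - b) != 0 by rewrite gt_eqF// Gamma_gt0.
    rewrite (_ : LG = (Gamma (1 - b))^-1 * s * (Gamma (1 - b) * (s^-1 * LG))).
      by rewrite h; field.
    by field; rewrite g0 gt_eqF.
  rewrite h mulrCA mulrC; congr (_ * _).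
  rewrite -{1}(powRr1 (ltW s0)) -powRD ?(gt_eqF s0) ?implybT//.
  by congr (_ `^ _); ring.
(* degree 2: two integrations; the first one needs the first derivative, which is
   bounded on bounded intervals only *)
have b12 : 1 < b <= 2 by rewrite b1.
rewrite caputo_degree2//= => af.
have af0 := af 0%N isT; have af1 := af 1%N isT; rewrite /= in af0 af1.
have f'0' := f'0 b1.
have {}DF t : 0 < t -> leb.-integrable `]0, t[ (EFin \o (derive1 f)) /\
    prim (derive1 f) t = f t - f 0 by exact: prim_derive1.
have {}DF' t : 0 < t -> leb.-integrable `]0, t[ (EFin \o (derive1 (derive1 f))) /\
    prim (derive1 (derive1 f)) t = (derive1 f) t - 0 by exact: prim_derive1.
have [iPPG lPPG] := lap_prim s0 iPG.
have [b2e _|b2n dG] := eqVneq b 2%:R.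
  rewrite b2e powR_mulrn ?(ltW s0)//.
  have s2 : s ^- 2 != 0 by rewrite invr_neq0// expf_neq0// gt_eqF.
  apply: (mulfI s2); rewrite mulrA mulVf ?mul1r; last by rewrite expf_neq0// gt_eqF.
  rewrite -exprVn expr2 -mulrA -b2e -lPG -lPPG; apply: eq_lap => t t0.
  have [_ <-] := DF t t0; apply: eq_prim => r r0.
  have [_ h] := DF' r r0; rewrite subr0 in h; rewrite -h; apply: eq_prim => u u0.
  by rewrite /caputo caputo_degree2//= b2e eqxx.
have p01 : 0 < 2 - b <= 1.
  by rewrite subr_gt0 lt_neqAle b2n b2/= lerBlDl -[leLHS]/(1 + 1) lerD2r ltW.
have [ik lk] := lap_powR p01 s0.
have GE t : 0 < t -> convol (fun r => r `^ (2 - b - 1)) (derive1 (derive1 f)) t =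
    Gamma (2 - b) * caputo b f t.
  move=> t0; rewrite /caputo caputo_degree2//= (negbTE b2n) mulrA divff ?mul1r//.
  by rewrite gt_eqF// Gamma_gt0.
have g0 : Gamma (2 - b) != 0 by rewrite gt_eqF// Gamma_gt0.
have mf' : measurable_fun pos (derive1 f).
  apply: open_continuous_measurable_fun; first exact: interval_open.
  move=> x; rewrite inE/= in_itv/= andbT => x0; exact: loc_abs_cont_continuous.
have f'B u : 0 < u -> exists C'', forall t, 0 < t < u -> `|(derive1 f) t| <= C''.
  move=> u0; have [iu _] := DF' u u0.
  exists (\int[leb]_(r in `]0, u[) `|derive1 (derive1 f) r|) => t /andP[t0 tu].
  have [it h] := DF' t t0; rewrite subr0 in h; rewrite -h.
  apply: le_trans (le_normr_Rintegral _ _) _ => //.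
  rewrite /Rintegral fine_le//.
  - by apply: integrable_fin_num => //; exact: integrable_norm it.
  - by apply: integrable_fin_num => //; exact: integrable_norm iu.
  - apply: ge0_subset_integral => //.
    + by have /integrableP[] := integrable_norm iu.
    + by apply: subset_itvl; rewrite bnd_simp ltW.
have dG' u : 0 < u -> leb.-integrable `]0, u[
    (fun r => ((u - r) `^ (2 - b - 1) * (derive1 f) r)%:E).
  move=> u0; have [C'' hC] := f'B u u0.
  have [ikr _] := Rintegral_reflect (integrable_powR u p01).
  apply: (integrableMr_bounded _ ikr (C := C'')) => //.
  by apply: measurable_funS mf' => //; exact: subset_itvl.
have E t : 0 < t -> Gamma (2 - b) * prim (prim (caputo b f)) t =
    convol (fun x => f x - f 0) (fun r => r `^ (2 - b - 1)) t.
  move=> t0; rewrite -(prim_convol_derive1 af0 f0)//; last first.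
    by move=> u _; exact: integrable_powR.
  rewrite /prim -RintegralZl//; last exact: lap_integrable_itv iPG.
  apply: eq_prim => r r0.
  transitivity (prim (convol (fun r => r `^ (2 - b - 1)) (derive1 (derive1 f))) r).
    rewrite (eq_prim _ GE) /prim RintegralZl//.
    exact: lap_integrable_itv iG.
  rewrite (prim_convol_derive1 af1 f'0')//; last first.
    by move=> u _; exact: integrable_powR.
  have [_ h] := Rintegral_reflect (dG' _ r0); rewrite [RHS]/convol -h.
  apply: eq_Rintegral => v _; rewrite subr0 mulrC; congr (_ `^ _ * _).
  by rewrite opprB addrC subrK.
have := lap_bounded_convol s0 mF FC ik.
rewrite -(eq_lap _ E); have [_ ->] := lapZ (Gamma (2 - b)) iPPG.
rewrite lPPG lPG lk.
set LG := lap (caputo b f) s; set LF := lap _ s => h.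
have {}h : LG = s ^+ 2 * (LF * s `^ (- (2 - b))).
  rewrite (_ : LG =
    (Gamma (2 - b))^-1 * s ^+ 2 * (Gamma (2 - b) * (s^-1 * (s^-1 * LG)))).
    by rewrite h; field.
  by field; rewrite g0 gt_eqF.
rewrite h mulrCA mulrC; congr (_ * _).
rewrite -(powR_mulrn _ (ltW s0)) -powRD ?(gt_eqF s0) ?implybT//.
by congr (_ `^ _); ring.
Qed.

End caputo_laplace.

(** * Uniqueness of the Laplace transform *)

Section laplace_uniqueness.
Context {R : realType}.
Local Notation leb := (@lebesgue_measure R).
Local Notation pos := (`]0%R, +oo[%classic : set R).
Implicit Types (f g h k : R -> R) (s t u b : R).

Definition lap_null f := [/\ measurable_fun pos f,
  exists C : R, forall t, 0 < t -> `|f t| <= C & forall s, 0 < s -> lap f s = 0].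

Lemma lap_null_integrable f s : lap_null f -> 0 < s -> lap_integrable f s.
Proof. by move=> [mf [C fC] _] s0; exact: bounded_lap_integrable mf fC. Qed.

Lemma lap_nullZ c f : lap_null f -> lap_null (fun t => c * f t).
Proof.
move=> nf; have [mf [C fC] f0] := nf; split.
- exact: measurable_funM.
- by exists (`|c| * C) => t t0; rewrite normrM ler_wpM2l// fC.
- move=> s s0; have [_ ->] := lapZ c (lap_null_integrable nf s0).
  by rewrite f0// mulr0.
Qed.

Lemma lap_nullD f g : lap_null f -> lap_null g -> lap_null (fun t => f t + g t).
Proof.
move=> nf ng; have [mf [C fC] f0] := nf; have [mg [D gD] g0] := ng; split.
- exact: measurable_funD.
- by exists (C + D) => t t0; rewrite (le_trans (ler_normD _ _))// lerD ?fC ?gD.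
- move=> s s0.
  have [_ ->] := lapD (lap_null_integrable nf s0) (lap_null_integrable ng s0).
  by rewrite f0// g0// addr0.
Qed.

Lemma lap_null_expR f : lap_null f -> lap_null (fun t => expR (- t) * f t).
Proof.
move=> [mf [C fC] f0]; split.
- apply: measurable_funM => //; apply: measurable_funTS.
  by apply: measurableT_comp; [exact: measurable_expR|exact: oppr_measurable].
- exists C => t t0; rewrite normrM (le_trans _ (fC t t0))// ler_piMl//.
  by rewrite ger0_norm ?expR_ge0// expR_le1 oppr_le0 ltW.
- move=> s s0; rewrite -(f0 (s + 1)) ?addr_gt0//.
  apply: eq_Rintegral => t _; rewrite mulrA -expRD; congr (expR _ * _); ring.
Qed.

(** Multiplication by [expR (- t)] shifts the transform, so the functions with zero
    transform are stable under multiplication by polynomials in [expR (- t)]. *)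
Lemma lap_null_bump f (x : R) (N : nat) : lap_null f ->
  lap_null (fun t => (1 - (expR (- t) - x) ^+ 2) ^+ N * f t).
Proof.
move=> nf; elim: N => [|N IH]; first by under eq_fun do rewrite expr0 mul1r.
have n1 := lap_null_expR IH; have n2 := lap_null_expR n1.
have := lap_nullD (lap_nullD (lap_nullZ (1 - x ^+ 2) IH) (lap_nullZ (2 * x) n1))
  (lap_nullZ (- 1) n2).
by congr lap_null; apply/funext => t; rewrite [in RHS]exprS; ring.
Qed.

(** If [f t] were positive, multiplying [f] by the [N]-th power of
    [1 - (expR (- u) - expR (- t)) ^+ 2] would concentrate its integral near [t]: there the
    contribution is at least [c * kappa * A ^+ N] with [A] the value of the base at half the
    critical distance [rho], while the rest is at most [C * B ^+ N] with [B < A]. The sum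
    vanishes for every [N], which is impossible. *)
Lemma lap_null_le0 f t : lap_null f -> 0 < t -> {for t, continuous f} -> f t <= 0.
Proof.
move=> nf t0 cf; rewrite leNgt; apply/negP => ft0.
have [_ [C fC] _] := nf.
pose c := f t / 2; have c0 : 0 < c by rewrite divr_gt0.
have C0 : 0 < C by rewrite (lt_le_trans ft0)// (le_trans (ler_norm _))// fC.
have : \forall u \near t, c < f u.
  by apply: (cvgr_gt _ cf); rewrite /c; lra.
move=> /nbhs_ballP[e /= e0 fe].
pose eta := Num.min e t.
have eta0 : 0 < eta by rewrite lt_min e0.
have fcI u : `|t - u| < eta -> c < f u.
  by move=> tu; apply: fe; rewrite /ball/= (lt_le_trans tu)// ge_min lexx.
pose x := expR (- t).
(* outside of the interval of radius [eta] the points [expR (- u)] and [x] are at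
   distance at least [rho] *)
pose rho := Num.min (expR (- (t - eta)) - x) (x - expR (- (t + eta))).
have rho0 : 0 < rho.
  by rewrite lt_min !subr_gt0 !ltr_expR; apply/andP; split; lra.
have x1 : x <= 1 by rewrite expR_le1 oppr_le0 ltW.
have rho1 : rho <= 1.
  by rewrite ge_min; apply/orP; right; rewrite lerBlDr (le_trans x1)// lerDl expR_ge0.
have rhoE u : 0 < u -> eta <= `|t - u| -> rho <= `|expR (- u) - x|.
  move=> u0; case: (leP u t) => ut.
    rewrite ger0_norm ?subr_ge0// => h; rewrite (@le_trans _ _ (expR (- u) - x))//.
      rewrite ge_min; apply/orP; left; rewrite lerD2r ler_expR; lra.
    exact: ler_norm.
  rewrite ltr0_norm ?subr_lt0// opprB => h.
  rewrite -normrN opprB (@le_trans _ _ (x - expR (- u)))//; last exact: ler_norm.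
  rewrite ge_min; apply/orP; right; rewrite lerD2l lerN2 ler_expR; lra.
have : \forall u \near t, `|expR (- u) - x| < rho / 2.
  have cE : {for t, continuous (fun u : R => expR (- u))}.
    apply: continuous_comp; first exact: opp_continuous.
    exact: continuous_expR.
  have /cvgrPdistC_lt := cE; apply.
  by rewrite divr_gt0.
move=> /nbhs_ballP[e' /= e'0 ee].
(* on the interval of radius [et] they are at distance less than [rho / 2] *)
pose et := Num.min e' eta.
have et0 : 0 < et by rewrite lt_min e'0.
have ett : et <= t by rewrite !ge_min lexx !orbT.
pose I := `]t - et, t + et[%classic : set R.
have IE u : I u -> `|t - u| < et.
  by rewrite /I/= in_itv/= => /andP[h1 h2]; rewrite ltr_norml; apply/andP; split; lra.
pose A := 1 - (rho / 2) ^+ 2; pose B := 1 - rho ^+ 2.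
have rho2 : rho ^+ 2 <= 1 by rewrite expr_le1// ltW.
have rho20 : 0 < rho ^+ 2 by rewrite exprn_gt0.
have AE : A = 1 - rho ^+ 2 / 4 by rewrite /A expr_div_n; congr (_ - _ / _); ring.
have A0 : 0 < A by rewrite AE; lra.
have B0 : 0 <= B by rewrite /B; lra.
have BA : B < A by rewrite AE /B; lra.
have mI : measurable I by exact: measurable_itv.
have m1I : measurable_fun pos (\1_I : R -> R) by exact: measurable_indic.
have b1I r : `|\1_I r| <= 1 :> R.
  by rewrite indicE; case: (_ \in _); rewrite ?normr1 ?normr0.
have i1I := bounded_lap_integrable (@ltr01 R) m1I (fun r _ => b1I r).
have [i1 l1] := @lap_cst1 R 1 ltr01.
pose kappa := lap (\1_I) 1.
have kappa0 : 0 < kappa.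
  apply: (@lt_le_trans _ _ (expR (- (t + et)) * (2 * et))).
    by rewrite !mulr_gt0// expR_gt0.
  have E : \int[leb]_(r in pos) \1_I r = 2 * et.
    rewrite /Rintegral integral_indic//= setIidl; last first.
      by move=> r; rewrite /I/= !in_itv/= andbT => /andP[h _]; lra.
    rewrite lebesgue_measure_itv/= lte_fin ifT; last lra.
    by rewrite -EFinB/=; ring.
  have i1I' : leb.-integrable pos (EFin \o \1_I).
    have := @integrable_indic_itv R (t - et) (t + et) false true.
    by apply: integrableS.
  rewrite -E -RintegralZl//; apply: le_Rintegral => //.
    exact: integrable_scale.
  move=> r /=; rewrite in_itv/= andbT => r0.
  rewrite indicE; case: (boolP (r \in I)); last by rewrite !mulr0.
  rewrite inE/= /I/= in_itv/= => /andP[h1 h2]; rewrite !mulr1 ler_expR; lra.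
have key N : c * kappa * A ^+ N <= C * B ^+ N.
  have nN := lap_null_bump x N nf; have iN := lap_null_integrable nN (@ltr01 R).
  have [_ _ /(_ _ (@ltr01 R)) lN] := nN.
  have [j1 e1] := lapZ (c * A ^+ N) i1I; have [j2 e2] := lapZ (- (C * B ^+ N)) i1.
  have [j3 e3] := lapD j1 j2.
  have : lap (fun u => c * A ^+ N * \1_I u + - (C * B ^+ N) * cst 1 u) 1 <= 0.
    rewrite -lN; apply: le_Rintegral => //= r; rewrite in_itv/= andbT => r0.
    rewrite ler_pM2l ?expR_gt0// mulr1.
    have q0 : 0 <= 1 - (expR (- r) - x) ^+ 2.
      rewrite subr_ge0 -real_normK ?num_real// expr_le1// ler_norml.
      have e1' : expR (- r) <= 1 by rewrite expR_le1 oppr_le0 ltW.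
      have := expR_ge0 (- r); have := expR_ge0 (- t); rewrite -/x => ? ?.
      by apply/andP; split; lra.
    have qN0 := exprn_ge0 N q0.
    have BN0 : 0 <= C * B ^+ N by rewrite mulr_ge0 ?exprn_ge0 ?(ltW C0).
    have [rI|rI] := ltP `|t - r| eta.
      have fr := fcI _ rI.
      rewrite indicE; case: (boolP (r \in I)); last first.
        move=> _; rewrite mulr0 add0r (@le_trans _ _ 0)// ?oppr_le0//.
        by rewrite mulr_ge0// ltW// (lt_trans c0).
      rewrite inE => /IE Ir; rewrite mulr1 -[leRHS]addr0 lerD ?oppr_le0// mulrC.
      apply: ler_pM; [|exact: ltW| |exact: ltW].
        by rewrite exprn_ge0// ltW.
      rewrite lerXn2r ?nnegrE ?(ltW A0)// /A lerD2l lerN2.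
      rewrite -(real_normK (num_real (expR (- r) - x))).
      rewrite lerXn2r ?nnegrE ?divr_ge0 ?(ltW rho0)// ltW//.
      by apply: ee; rewrite /ball/= (lt_le_trans Ir)// ge_min lexx.
    have -> : \1_I r = 0 :> R.
      rewrite indicE memNset//; move=> /IE; rewrite ltNge => /negP; apply.
      by rewrite (le_trans _ rI)// ge_min lexx orbT.
    rewrite mulr0 add0r.
    apply: (@le_trans _ _ (- ((1 - (expR (- r) - x) ^+ 2) ^+ N * C))); last first.
      rewrite -mulrN ler_wpM2l// lerNl.
      by rewrite (le_trans (ler_norm _))// normrN fC.
    rewrite lerN2 mulrC ler_wpM2l ?(ltW C0)// lerXn2r ?nnegrE// /B lerD2l lerN2.
    rewrite -(real_normK (num_real (expR (- r) - x))) lerXn2r ?nnegrE ?(ltW rho0)//.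
    exact: rhoE.
  rewrite e3 e1 e2 l1 invr1 mulr1 subr_le0; apply: le_trans.
  by rewrite -/kappa mulrAC.
have /cvgrPdist_lt /(_ (c * kappa / C)) cv : (B / A) ^+ n @[n --> \oo] --> (0 : R).
  apply: cvg_expr; rewrite ger0_norm ?divr_ge0 ?(ltW A0)//.
  by rewrite ltr_pdivrMr// mul1r.
have [|N _ /(_ N (leqnn N))] := cv; first by rewrite divr_gt0// mulr_gt0.
rewrite /= sub0r normrN ger0_norm ?exprn_ge0 ?divr_ge0 ?(ltW A0)//.
rewrite ltr_pdivlMr// expr_div_n mulrAC ltr_pdivrMr ?exprn_gt0// mulrC.
by rewrite ltNge key.
Qed.

Lemma lap_unique f t : lap_null f -> 0 < t -> {for t, continuous f} -> f t = 0.
Proof.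
move=> nf t0 cf; apply/eqP; rewrite eq_le lap_null_le0//=.
have := lap_null_le0 (lap_nullZ (-1) nf) t0; rewrite mulN1r oppr_le0; apply.
by apply: cvgM => //; exact: cvg_cst.
Qed.

End laplace_uniqueness.

(** * Functions that are infinitely differentiable on an open set *)

Section smooth.
Context {R : realType}.
Implicit Types (f g : R -> R) (D : set R) (x a b : R).

(** [k]-fold differentiability on [D]. As [D] is meant to be open, only the values on [D]
    matter, see [ck_ext]; the recursion on the derivative suits inductive proofs. *)
Fixpoint ck (k : nat) D f : Prop :=
  if k is k'.+1 then (forall x, D x -> derivable f x 1) /\ ck k' D (derive1 f)
  else True.

Definition smooth D f := forall k, ck k D f.

Lemma derive1_val f x d : is_derive x (1 : R) f d -> derive1 f x = d.
Proof. by move=> h; rewrite derive1E; exact: derive_val. Qed.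

Lemma eq_on_near D f g x : open D -> D x -> (forall y, D y -> f y = g y) ->
  {near x, f =1 g}.
Proof.
by move=> oD Dx fg; near=> y; apply: fg; near: y; exact: open_nbhs_nbhs.
Unshelve. all: by end_near. Qed.

Lemma eq_on_derivable D f g : open D -> (forall y, D y -> f y = g y) ->
  (forall x, D x -> derivable f x 1) -> forall x, D x -> derivable g x 1.
Proof.
move=> oD fg df x Dx; apply: near_eq_derivable (df x Dx) => //.
exact: eq_on_near fg.
Qed.

Lemma eq_on_derive1 D f g : open D -> (forall y, D y -> f y = g y) ->
  forall x, D x -> derive1 f x = derive1 g x.
Proof.
move=> oD fg x Dx; rewrite !derive1E; apply: near_eq_derive => //.
exact: eq_on_near fg.
Qed.

Lemma ck_ext k D f g : open D -> (forall x, D x -> f x = g x) ->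
  ck k D f -> ck k D g.
Proof.
move=> oD; elim: k f g => //= k IH f g fg [df cf]; split.
  exact: eq_on_derivable df.
by apply: IH cf; exact: eq_on_derive1.
Qed.

Lemma ckW k D f : ck k.+1 D f -> ck k D f.
Proof. by elim: k f => //= k IH f [df cf]; split => //; exact: IH. Qed.

Lemma ck_cst k D c : ck k D (cst c).
Proof.
elim: k c => //= k IH c; split=> [x _|]; first exact: derivable_cst.
suff -> : derive1 (cst c) = cst 0 :> (R -> R) by exact: IH.
by apply/funext => x; rewrite derive1_cst.
Qed.

Lemma ckD k D f g : open D -> ck k D f -> ck k D g -> ck k D (fun x => f x + g x).
Proof.
move=> oD; elim: k f g => //= k IH f g [df cf] [dg cg]; split.
  by move=> x Dx; apply: derivableD; [exact: df|exact: dg].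
apply: (ck_ext oD _ (IH _ _ cf cg)) => x Dx.
by rewrite !derive1E deriveD//; [exact: df|exact: dg].
Qed.

Lemma ckM k D f g : open D -> ck k D f -> ck k D g -> ck k D (fun x => f x * g x).
Proof.
move=> oD; elim: k f g => // k IH f g cf cg.
have [df cf'] := cf; have [dg cg'] := cg; split.
  by move=> x Dx; apply: derivableM; [exact: df|exact: dg].
apply: (ck_ext oD _ (ckD oD (IH _ _ cf' (ckW cg)) (IH _ _ (ckW cf) cg'))) => x Dx.
rewrite !derive1E (deriveM (df x Dx) (dg x Dx)) /GRing.scale/= addrC.
by congr (_ + _); exact: mulrC.
Qed.

Lemma ckZ k D c f : open D -> ck k D f -> ck k D (fun x => c * f x).
Proof. by move=> oD cf; apply: ckM => //; exact: ck_cst. Qed.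

Lemma ckU k D1 D2 f : ck k D1 f -> ck k D2 f -> ck k (D1 `|` D2) f.
Proof.
elim: k f => //= k IH f [d1 c1] [d2 c2]; split; last exact: IH.
by move=> x [/d1|/d2].
Qed.

Lemma ckS k D1 D2 f : D1 `<=` D2 -> ck k D2 f -> ck k D1 f.
Proof.
move=> D12; elim: k f => //= k IH f [d2 c2]; split; last exact: IH.
by move=> x /D12 /d2.
Qed.

Lemma is_derive_affine f a b x : derivable f (a * x + b) 1 ->
  is_derive x (1 : R) (fun x => f (a * x + b)) (a * derive1 f (a * x + b)).
Proof.
move=> df.
have dg : is_derive x (1 : R) (fun x => a * x + b) a.
  have -> : (fun x => a * x + b) = (a \*: (@id R)) + (cst b) by [].
  by apply: is_derive_eq; rewrite addr0 /GRing.scale/= mulr1.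
have dh : is_derive (a * x + b) (1 : R) f ('D_1 f (a * x + b)).
  exact: derivableP.
by have := @is_derive1_comp R f (fun x => a * x + b) x _ _ dh dg; rewrite derive1E mulrC.
Qed.

Lemma ck_affine k D D' f a b : open D' -> (forall x, D' x -> D (a * x + b)) ->
  ck k D f -> ck k D' (fun x => f (a * x + b)).
Proof.
move=> oD' DD'; elim: k f => //= k IH f [df cf]; split.
  by move=> x /DD' /df dx; exact: (ex_derive (is_derive := is_derive_affine dx)).
apply: (ck_ext oD' _ (ckZ a oD' (IH _ cf))) => x /DD' /df dx.
by rewrite (derive1_val (is_derive_affine dx)).
Qed.

Lemma smooth_test f : smooth setT f <-> forall k x, derivable f^`(k) x 1.
Proof.
split=> [sf k x|sf k].
  have : ck k.+1 setT f by exact: sf.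
  elim: k f {sf} => [|k IH] f [df cf]; first exact: df.
  by rewrite derive1Sn; exact: IH.
elim: k f sf => //= k IH f sf; split=> [x _|]; first exact: (sf 0%N).
by apply: IH => n x; have := sf n.+1 x; rewrite derive1Sn.
Qed.

Lemma smooth_derive1 D f : smooth D f -> smooth D (derive1 f).
Proof. by move=> sf k; have [] := sf k.+1. Qed.

Lemma smooth_derivable D f : smooth D f -> forall x, D x -> derivable f x 1.
Proof. by move=> /(_ 1%N)[]. Qed.

Lemma smooth_continuous D f : smooth D f -> forall x, D x -> {for x, continuous f}.
Proof.
move=> sf x Dx; apply: differentiable_continuous; apply/derivable1_diffP.
exact: smooth_derivable sf _ Dx.
Qed.

(** The equation expresses the next derivative by functions already known to be
    differentiable. *)
Lemma smooth_ode D f g c : open D -> smooth D g ->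
  (forall x, D x -> is_derive x (1 : R) f (g x + c * f x)) -> smooth D f.
Proof.
move=> oD sg df; elim=> //= k IH; split=> [x /df h|]; first exact: ex_derive.
apply: (ck_ext oD _ (ckD oD (sg k) (ckZ c oD IH))) => x /df h.
by rewrite (derive1_val h).
Qed.

End smooth.

(** * Flat functions and smooth cutoffs *)

Section flat.
Context {R : realType}.
Implicit Types (P Q : {poly R}) (x y : R).

(** For every polynomial [P] the function is infinitely differentiable and flat at the
    origin; [P = 1] gives the classical function [expR (- x^-1)]. *)
Definition flat P x : R := if 0 < x then P.[x^-1] * expR (- x^-1) else 0.

Lemma flat_le0 P x : x <= 0 -> flat P x = 0.
Proof. by rewrite /flat leNgt => /negbTE ->. Qed.

Lemma flat_gt0 P x : 0 < x -> flat P x = P.[x^-1] * expR (- x^-1).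
Proof. by rewrite /flat => ->. Qed.

Lemma expR_dominates_pow n y : 0 <= y -> y ^+ n * expR (- y) <= n`!%:R.
Proof.
move=> y0; rewrite expRN ler_pdivrMr ?expR_gt0//.
case: n => [|n]; first by rewrite expr0 fact0 mul1r -expR0 ler_expR.
rewrite mulrC -ler_pdivrMr ?ltr0n ?fact_gt0//.
by apply: le_trans (expR_ge1Dxn n y0); rewrite lerDr.
Qed.

Lemma flat_bounded P : exists2 C : R, 0 <= C & forall x, `|flat P x| <= C.
Proof.
exists (\sum_(i < size P) `|P`_i| * i`!%:R).
  by apply: sumr_ge0 => i _; rewrite mulr_ge0.
move=> x; case: (leP x 0) => x0.
  by rewrite flat_le0// normr0; apply: sumr_ge0 => i _; rewrite mulr_ge0.
have y0 : 0 <= x^-1 by rewrite invr_ge0 ltW.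
rewrite flat_gt0// normrM (ger0_norm (expR_ge0 _)) horner_coef.
apply: (@le_trans _ _ ((\sum_(i < size P) `|P`_i * x^-1 ^+ i|) * expR (- x^-1))).
  by rewrite ler_wpM2r ?expR_ge0// ler_norm_sum.
rewrite mulr_suml; apply: ler_sum => i _.
rewrite normrM -mulrA ler_wpM2l// ger0_norm ?exprn_ge0//.
exact: expR_dominates_pow.
Qed.

Lemma flat_mulX P x : 0 < x -> x * flat ('X * P) x = flat P x.
Proof.
move=> x0; rewrite !flat_gt0// hornerM hornerX.
by rewrite !mulrA divff ?mul1r// gt_eqF.
Qed.

(** The family of flat functions is stable under derivation: with [y = x^-1], the
    derivative of [P.[y] * expR (- y)] with respect to [x] is
    [y ^+ 2 * (P.[y] - P'.[y]) * expR (- y)]. *)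
Definition flat_deriv P : {poly R} := 'X * ('X * (P - deriv P)).

(** At the origin the difference quotient is [x] times another flat function, and flat
    functions are bounded. *)
Lemma is_derive_flat P x : is_derive x (1 : R) (flat P) (flat (flat_deriv P) x).
Proof.
have [x0|x0|->] := ltgtP x 0.
- rewrite flat_le0 ?ltW//; apply: (near_eq_is_derive (f := cst 0)) => //.
  + near=> y; rewrite flat_le0// ltW//; near: y; exact: lt_nbhsl.
- have dV : is_derive x (1 : R) (fun y : R => y^-1) (- x^-1 ^+ 2).
    have dx : derivable (@id R) x 1 by exact: derivable_id.
    have x0n : @id R x != 0 by rewrite gt_eqF.
    have h := derivableP (derivableV x0n dx).
    apply: (is_derive_eq h); rewrite deriveV// derive_id /GRing.scale/= mulr1.
    by rewrite exprVn.
  have dP : is_derive x (1 : R) (horner P \o (fun y : R => y^-1))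
      ((deriv P).[x^-1] * (- x^-1 ^+ 2)).
    exact: is_derive1_comp.
  have dE : is_derive x (1 : R) (expR \o (fun y : R => - y^-1))
      (expR (- x^-1) * - (- x^-1 ^+ 2)).
    have dN : is_derive x (1 : R) (fun y : R => - y^-1) (- - x^-1 ^+ 2).
      exact: is_deriveN.
    apply: is_derive1_comp; exact: is_derive_expR.
  apply: (near_eq_is_derive
    (f := (horner P \o (fun y : R => y^-1)) * (expR \o (fun y : R => - y^-1)))) => //.
    near=> y; rewrite flat_gt0//; near: y; exact: lt_nbhsr.
  apply: is_derive_eq; rewrite flat_gt0// /flat_deriv !hornerM hornerX hornerD hornerN.
  by rewrite /GRing.scale/=; ring.
rewrite flat_le0//.
have [C C0 hC] := flat_bounded ('X * ('X * P)).
have C1 : 0 < C + 1 by rewrite ltr_wpDl.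
have cv : h^-1 *: ((flat P \o shift 0) (h *: (1 : R)) - flat P 0) @[h --> (0 : R)^'] --> (0 : R).
  apply/cvgrPdist_le => /= e e0; near=> h.
  rewrite (flat_le0 P (lexx 0)) subr0 sub0r normrN /shift/= addr0 /GRing.scale/= mulr1.
  case: (leP h 0) => h0; first by rewrite flat_le0// mulr0 normr0 ltW.
  rewrite -(flat_mulX P h0) mulrA mulVf ?gt_eqF// mul1r -flat_mulX//.
  rewrite normrM (@le_trans _ _ (`|h| * (C + 1)))//.
    by rewrite ler_wpM2l// (le_trans (hC h))// lerDl.
  rewrite -ler_pdivlMr//; near: h; apply: dnbhs0_le; exact: divr_gt0.
apply: DeriveDef; [exact: cvgP cv|exact: cvg_lim cv].
Unshelve. all: by end_near. Qed.

Lemma derive1_flat P : derive1 (flat P) = flat (flat_deriv P).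
Proof.
by apply/funext => x; exact: (derive1_val (is_derive_flat P x)).
Qed.

Lemma smooth_flat P (D : set R) : smooth D (flat P).
Proof.
move=> k; elim: k P => //= k IH P; rewrite derive1_flat; split => // x _.
exact: (ex_derive (is_derive := is_derive_flat P x)).
Qed.

Lemma flat_cvg P (u : nat -> R) : u n @[n --> \oo] --> +oo ->
  flat P (u n) @[n --> \oo] --> P.[0].
Proof.
move=> uy.
have cV : (u n)^-1 @[n --> \oo] --> (0 : R).
  apply/gtr0_cvgV0 => //; exact: (cvgryPgt _).1 uy 0.
have E : {near \oo, (fun n => P.[(u n)^-1] * expR (- (u n)^-1)) =1
    (fun n => flat P (u n))}.
  near=> n; rewrite flat_gt0//; near: n; exact: (cvgryPgt _).1 uy 0.
apply: (cvg_trans (near_eq_cvg E)).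
have : P.[(u n)^-1] * expR (- (u n)^-1) @[n --> \oo] --> P.[0] * expR (- 0).
  apply: cvgM.
    exact: (continuous_cvg _ (continuous_horner (x := 0)) cV).
  have cN : - (u n)^-1 @[n --> \oo] --> (- 0 : R) by exact: cvgN.
  exact: (continuous_cvg _ (continuous_expR (x := - 0)) cN).
by rewrite oppr0 expR0 mulr1.
Unshelve. all: by end_near. Qed.

(** It vanishes for [x <= 0] and increases to [1] at infinity. *)
Definition cutoff : R -> R := flat 1.

Lemma cutoff_ge0 x : 0 <= cutoff x.
Proof. by rewrite /cutoff /flat; case: ifP => // _; rewrite hornerC mul1r expR_ge0. Qed.

Lemma cutoff_le1 x : cutoff x <= 1.
Proof.
rewrite /cutoff /flat; case: ifP => // x0.
by rewrite hornerC mul1r expR_le1 oppr_le0 invr_ge0 ltW.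
Qed.

Lemma cutoff_norm x : `|cutoff x| <= 1.
Proof. by rewrite ger0_norm ?cutoff_le1// cutoff_ge0. Qed.

Lemma affine_cvgy (a b : R) : 0 < a -> a * n%:R + b @[n --> \oo] --> +oo.
Proof.
move=> a0; apply/cvgryPge => M.
near=> n; rewrite -lerBlDr mulrC -ler_pdivrMr//.
by near: n; exact: nbhs_infty_ger.
Unshelve. all: by end_near. Qed.

Lemma flat_cvg_shift P x : flat P (n%:R - x) @[n --> \oo] --> P.[0].
Proof.
apply: flat_cvg; have := affine_cvgy (- x) ltr01.
by under eq_fun do rewrite mul1r.
Qed.

Lemma flat_cvg_scale P x : 0 < x -> flat P (n%:R * x - 1) @[n --> \oo] --> P.[0].
Proof.
move=> x0; apply: flat_cvg; have := affine_cvgy (- 1) x0.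
by under eq_fun do rewrite mulrC.
Qed.

End flat.

(** * Dominated convergence for real integrals *)

Section dominated.
Context {R : realType} d (T : measurableType d).
Variables (mu : {measure set T -> \bar R}) (D : set T).
Hypothesis mD : measurable D.

Lemma Rintegral_dominated (f_ : nat -> T -> R) (f g : T -> R) :
  (forall n, measurable_fun D (f_ n)) ->
  (forall x, D x -> f_ n x @[n --> \oo] --> f x) ->
  mu.-integrable D (EFin \o g) ->
  (forall n x, D x -> `|f_ n x| <= g x) ->
  [/\ measurable_fun D f, mu.-integrable D (EFin \o f) &
    \int[mu]_(x in D) f_ n x @[n --> \oo] --> \int[mu]_(x in D) f x].
Proof.
move=> mf fcv ig fg.
have mlim : measurable_fun D f by exact: (measurable_fun_cvg mf fcv).
have [|||||i1 _ cv] := @dominated_convergence _ T R mu D mD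
  (fun n x => (f_ n x)%:E) (EFin \o f) (EFin \o g).
- by move=> n; exact/measurable_EFinP.
- exact/measurable_EFinP.
- by apply: aeW => x Dx; apply: cvg_EFin; [exact: nearW|exact: fcv].
- exact: ig.
- by apply: aeW => x n Dx; rewrite /= lee_fin fg.
split => //.
apply: (@fine_cvg _ _ _ _ (fun n => \int[mu]_(x in D) (f_ n x)%:E)%E).
rewrite /Rintegral fineK//; exact: integrable_fin_num.
Qed.

End dominated.

(** * The folded diffusion against test functions *)

Section test_functions.
Context {R : realType}.
Implicit Types (f phi : R -> R).

Lemma test_bounded phi : test_function phi ->
  exists2 C : R, 0 <= C & forall x, `|phi x| <= C.
Proof.
move=> [sphi [M M0]].
have cphi : continuous phi.
  by move=> x; apply: (smooth_continuous (D := setT)) => //; exact/smooth_test.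
pose N := `|M| + 1; have N0 : - N <= N by rewrite /N; have := normr_ge0 M; lra.
have cn : {within `[- N, N], continuous (fun x => `|phi x|)}.
  apply: continuous_subspaceT => x; apply: continuous_comp; first exact: cphi.
  exact: norm_continuous.
have [c _ hc] := EVT_max N0 cn.
exists `|phi c| => // x; case: (boolP (x \in `[- N, N]%R)) => [|xN]; first exact: hc.
rewrite M0 ?normr0//.
rewrite ltNge; apply: contra xN => xM; rewrite in_itv/= -ler_norml.
by rewrite (le_trans xM)// /N (le_trans (ler_norm _))// lerDl.
Qed.

Lemma test_derive1 phi : test_function phi -> test_function (derive1 phi).
Proof.
move=> [sphi [M M0]]; split=> [k x|].
  by rewrite -derive1Sn; exact: sphi.
exists M => x Mx; rewrite -[RHS](derive1_cst (0 : R) x).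
have oD : open [set y : R | M < `|y|].
  rewrite (_ : [set y : R | M < `|y|] = (fun y : R => `|y|) @^-1` `]M, +oo[); last first.
    by apply/seteqP; split => y /=; rewrite in_itv/= andbT.
  by apply: open_comp => [y _|]; [exact: norm_continuous|exact: interval_open].
by rewrite (@eq_on_derive1 R [set y | M < `|y|] phi (cst 0) oD)//.
Qed.

Lemma smooth_test_function f M : smooth setT f -> (forall x, x <= 0 -> f x = 0) ->
  (forall x, M < x -> f x = 0) -> test_function f.
Proof.
move=> /smooth_test sf f0 fM; split => //; exists M => x Mx.
by have [/f0//|x0] := leP x 0; apply: fM; rewrite -(gtr0_norm x0).
Qed.

End test_functions.

Section half_line_expectation.
Context {R : realType}.
Local Notation pos := (`]0%R, +oo[%classic : set R).
Variables (b : R) (u : R -> probability R R).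
Hypothesis b02 : 0 < b <= 2.
Hypothesis diffu : fractional_diffusion b u.
Hypothesis upos : forall t, 0 < t -> u t pos = (2^-1)%:E.
Implicit Types (f g phi psi : R -> R) (s t C : R).

(** If [u t] is the solution of the diffusion equation, this is the mean of [f] under the
    folded law, that is the mean of [f (T t)]. *)
Definition hexp f t := 2 * \int[u t]_(x in pos) f x.

Definition bounded_on (D : set R) f := exists C, forall x, D x -> `|f x| <= C.

Lemma integrable_bounded t f : measurable_fun pos f -> bounded_on pos f ->
  (u t).-integrable pos (EFin \o f).
Proof.
move=> mf [C fC]; apply: measurable_bounded_integrable => //.
- exact: le_lt_trans (probability_le1 _ _) (ltry _).
- exists C; split; first exact: num_real.
  by move=> M CM x /fC /le_trans; apply; exact: ltW.
Qed.

Lemma hexp_cst c t : 0 < t -> hexp (cst c) t = c.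
Proof.
move=> t0; rewrite /hexp Rintegral_cst//= upos//=.
by rewrite mulrC -mulrA mulVf ?mulr1// pnatr_eq0.
Qed.

Lemma hexpD f g t : measurable_fun pos f -> bounded_on pos f ->
  measurable_fun pos g -> bounded_on pos g ->
  hexp (fun x => f x + g x) t = hexp f t + hexp g t.
Proof.
move=> mf bf mg bg; rewrite /hexp RintegralD// ?mulrDr//; exact: integrable_bounded.
Qed.

Lemma hexpZ c f t : measurable_fun pos f -> bounded_on pos f ->
  hexp (fun x => c * f x) t = c * hexp f t.
Proof.
move=> mf bf; rewrite /hexp RintegralZl// 1?mulrCA//; exact: integrable_bounded.
Qed.

Lemma hexp_norm f C t : 0 < t -> measurable_fun pos f ->
  (forall x, 0 < x -> `|f x| <= C) -> `|hexp f t| <= C.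
Proof.
move=> t0 mf fC.
have fC' x : pos x -> `|f x| <= C by rewrite /= in_itv/= andbT => /fC.
rewrite /hexp normrM ger0_norm// -ler_pdivlMl//.
have ifn : (u t).-integrable pos (EFin \o f).
  by apply: integrable_bounded => //; exists C.
apply: le_trans (le_normr_Rintegral _ ifn) _ => //.
apply: (@le_trans _ _ (\int[u t]_(x in pos) C)).
  apply: le_Rintegral => //; first exact: integrable_norm ifn.
  apply: integrable_bounded => //; exists `|C| => x _; exact: lexx.
by rewrite Rintegral_cst//= upos//= mulrC.
Qed.

Lemma hexp_norm_le f g t : measurable_fun pos f -> measurable_fun pos g ->
  bounded_on pos g -> (forall x, 0 < x -> `|f x| <= g x) ->
  `|hexp f t| <= hexp g t.
Proof.
move=> mf mg bg fg; rewrite /hexp normrM ger0_norm// ler_wpM2l//.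
have fg' x : pos x -> `|f x| <= g x by rewrite /= in_itv/= andbT => /fg.
have bf : bounded_on pos f.
  case: bg => C gC; exists C => x px.
  by rewrite (le_trans (fg' _ px))// (le_trans (ler_norm _))// gC.
have if_ := integrable_bounded t mf bf; have ig := integrable_bounded t mg bg.
apply: le_trans (le_normr_Rintegral _ if_) _ => //.
by apply: le_Rintegral => //; exact: integrable_norm if_.
Qed.

Lemma hexp_cvg (f_ : nat -> R -> R) f C t : 0 < t ->
  (forall n, measurable_fun pos (f_ n)) ->
  (forall n x, 0 < x -> `|f_ n x| <= C) ->
  (forall x, 0 < x -> f_ n x @[n --> \oo] --> f x) ->
  hexp (f_ n) t @[n --> \oo] --> hexp f t.
Proof.
move=> t0 mf fC fcv; apply: cvgM; first exact: cvg_cst.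
have [|||||//] := @Rintegral_dominated R _ _ (u t) pos _ f_ f (cst C).
- by [].
- exact: mf.
- by move=> x; rewrite /= in_itv/= andbT => /fcv.
- by apply: integrable_bounded => //; exists `|C| => x _; exact: lexx.
- by move=> n x; rewrite /= in_itv/= andbT => /fC.
Qed.

Lemma hexp_test phi t : (forall x, x <= 0 -> phi x = 0) ->
  hexp phi t = 2 * \int[u t]_x phi x.
Proof.
move=> phi0; rewrite /hexp Rintegral_mkcond; congr (_ * _).
apply: eq_Rintegral => x _; rewrite patchE mem_setE in_itv/= andbT.
by case: ltP => // /phi0.
Qed.

Lemma eq_hexp f g t : (forall x, 0 < x -> f x = g x) -> hexp f t = hexp g t.
Proof.
move=> fg; congr (_ * _); apply: eq_Rintegral => x.
by rewrite inE/= in_itv/= andbT => /fg.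
Qed.

Lemma test_mean_continuous phi t : test_function phi -> 0 < t ->
  {for t, continuous (fun t => \int[u t]_x phi x)}.
Proof.
move=> tphi t0; have [_ /(_ _ tphi)[/= [_ + _] _ _]] := diffu.
move=> /(_ 0%N) ac; apply: loc_abs_cont_continuous => //; apply: ac.
by rewrite /caputo_degree absz_gt0 ceil_neq0; case/andP: b02 => ->; rewrite orbT.
Qed.

Lemma test_mean_norm phi C t : (forall x, `|phi x| <= C) -> measurable_fun setT phi ->
  `|\int[u t]_x phi x| <= C.
Proof.
move=> phiC mphi.
have ip f : measurable_fun setT f -> (forall x, `|f x| <= C) ->
    (u t).-integrable setT (EFin \o f).
  move=> mf fC; apply: measurable_bounded_integrable => //.
    exact: le_lt_trans (probability_le1 _ _) (ltry _).
  exists C; split; first exact: num_real.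
  by move=> M CM x _; apply: le_trans (fC x) _; exact: ltW.
have C0 : 0 <= C by exact: le_trans (phiC 0).
apply: le_trans (le_normr_Rintegral _ (ip _ mphi phiC)) _ => //.
apply: (@le_trans _ _ (\int[u t]_x C)).
  apply: le_Rintegral => //; first exact: integrable_norm (ip _ mphi phiC).
  by apply: ip => // x; rewrite ger0_norm.
by rewrite Rintegral_cst//= probability_setT/= mulr1.
Qed.

Lemma test_measurable phi : test_function phi -> measurable_fun setT phi.
Proof.
move=> [sphi _]; apply: continuous_measurable_fun => x.
by apply: (smooth_continuous (D := setT)) => //; exact/smooth_test.
Qed.

Lemma test_mean_measurable phi : test_function phi ->
  measurable_fun pos (fun t => \int[u t]_x phi x).
Proof.
move=> tphi; apply: open_continuous_measurable_fun; first exact: interval_open.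
move=> x; rewrite inE/= in_itv/= andbT => x0; exact: test_mean_continuous.
Qed.

(** The function of time satisfies the equation with the bounded right-hand side
    given by the second derivative of [phi], so [lap_caputo] applies. The Dirac mass at time [0]
    contributes [phi 0 = 0]. *)
Lemma lap_test_mean phi s : test_function phi -> phi 0 = 0 -> 0 < s ->
  lap (fun t => \int[u t]_x derive1 (derive1 phi) x) s =
  s `^ b * lap (fun t => \int[u t]_x phi x) s.
Proof.
move=> tphi phi0 s0.
have [u0 /(_ _ tphi)[/= Dg Eg g'0]] := diffu.
have tphi2 := test_derive1 (test_derive1 tphi).
have [C C0 hC] := test_bounded tphi; have [C2 C20 hC2] := test_bounded tphi2.
have mC t := test_mean_norm t hC (test_measurable tphi).
have mC2 t := test_mean_norm t hC2 (test_measurable tphi2).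
rewrite -(eq_lap (f := caputo b (fun t => \int[u t]_x phi x))) //.
rewrite (@lap_caputo R b _ s C C2)//.
- rewrite (_ : \int[u 0]_x phi x = 0) ?mul0r ?subr0//.
  rewrite /Rintegral (eq_measure_integral (dirac (0 : R))); last first.
    by move=> A mA _; exact: u0.
  rewrite integral_dirac//; first by rewrite diracT mul1e phi0.
  by apply/measurable_EFinP; exact: test_measurable.
- apply: eq_measurable_fun (test_mean_measurable tphi2) => t.
  by rewrite inE/= in_itv/= andbT => t0; rewrite Eg.
- by move=> t t0; rewrite Eg.
Qed.

End half_line_expectation.

(** * Truncation of smooth functions on the half line *)

Section truncation.
Context {R : realType}.
Local Notation pos := (`]0%R, +oo[%classic : set R).
Implicit Types (f g phi psi : R -> R) (x : R) (n : nat).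

(** It vanishes up to [1 / (n + 1)] and tends to [1] at every positive point. *)
Definition near0_cutoff n x : R := cutoff (n.+1%:R * x - 1).
(** It vanishes from [n + 1] on; it tends to [1] and its derivatives to [0], boundedly. *)
Definition infty_cutoff n x : R := cutoff (n.+1%:R - x).

Lemma open_pos : open pos. Proof. exact: interval_open. Qed.

Lemma smooth_near0_cutoff n : smooth setT (near0_cutoff n).
Proof.
move=> k; apply: (@ck_affine R k setT setT (flat 1) n.+1%:R (- 1)) => //.
  exact: openT.
exact: smooth_flat.
Qed.

Lemma infty_cutoffE n : infty_cutoff n = fun x => cutoff (- 1 * x + n.+1%:R).
Proof. by apply/funext => x; rewrite /infty_cutoff mulN1r addrC. Qed.

Lemma smooth_infty_cutoff n : smooth setT (infty_cutoff n).
Proof.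
rewrite infty_cutoffE => k.
apply: (@ck_affine R k setT setT (flat 1) (- 1) n.+1%:R) => //.
  exact: openT.
exact: smooth_flat.
Qed.

Lemma derive1_flat_shift (P : {poly R}) n :
  derive1 (fun x => flat P (n.+1%:R - x)) =
  fun x => - flat (flat_deriv P) (n.+1%:R - x).
Proof.
have E (Q : {poly R}) : (fun x => flat Q (n.+1%:R - x)) =
    fun x => flat Q (- 1 * x + n.+1%:R).
  by apply/funext => x; rewrite mulN1r addrC.
apply/funext => x; rewrite E.
have dx : derivable (flat P) (- 1 * x + n.+1%:R) 1.
  by apply: (smooth_derivable (D := setT)) => //; exact: smooth_flat.
rewrite (derive1_val (is_derive_affine dx)) derive1_flat mulN1r.
by congr (- flat _ _); rewrite mulN1r addrC.
Qed.

Lemma derive1_near0_cutoff n x :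
  derive1 (near0_cutoff n) x = n.+1%:R * flat (flat_deriv 1) (n.+1%:R * x - 1).
Proof.
have dx : derivable (flat (1 : {poly R})) (n.+1%:R * x + - 1) 1.
  by apply: (smooth_derivable (D := setT)) => //; exact: smooth_flat.
by rewrite (derive1_val (is_derive_affine dx)) derive1_flat.
Qed.

Lemma near0_cutoff0 n x : x <= n.+1%:R^-1 -> near0_cutoff n x = 0.
Proof.
by move=> xn; rewrite /near0_cutoff /cutoff flat_le0// subr_le0 -ler_pdivlMl// mulr1.
Qed.

Lemma infty_cutoff0 n x : n.+1%:R <= x -> infty_cutoff n x = 0.
Proof. by move=> xn; rewrite /infty_cutoff /cutoff flat_le0// subr_le0. Qed.

Lemma flat_cvg_near0 (P : {poly R}) x : 0 < x ->
  flat P (n.+1%:R * x - 1) @[n --> \oo] --> P.[0].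
Proof.
move=> x0; have := @flat_cvg_scale R P x x0.
by rewrite -(cvg_shiftS (fun n => flat P (n%:R * x - 1))).
Qed.

Lemma flat_cvg_infty (P : {poly R}) x :
  flat P (n.+1%:R - x) @[n --> \oo] --> P.[0].
Proof.
have := @flat_cvg_shift R P x.
by rewrite -(cvg_shiftS (fun n => flat P (n%:R - x))).
Qed.

Lemma cvg_near0_cutoff x : 0 < x -> near0_cutoff n x @[n --> \oo] --> (1 : R).
Proof. by move=> x0; have := @flat_cvg_near0 1 x x0; rewrite hornerC. Qed.

Lemma cvg_infty_cutoff x : infty_cutoff n x @[n --> \oo] --> (1 : R).
Proof. by have := @flat_cvg_infty 1 x; rewrite hornerC. Qed.

(** The product is smooth on the half line, and it vanishes on a neighbourhood of the
    negative half line, whatever [f] is there. *)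
Lemma smooth_cut_near0 f n : smooth pos f -> smooth setT (fun x => f x * near0_cutoff n x).
Proof.
move=> sf k; have -> : setT = pos `|` [set x : R | x < n.+1%:R^-1].
  apply/seteqP; split => // x _ /=; rewrite in_itv/= andbT.
  by case: (leP x 0) => x0; [right; rewrite (le_lt_trans x0)|left].
apply: ckU.
  apply: ckM; [exact: open_pos|exact: sf|].
  by apply: ckS (smooth_near0_cutoff n k).
apply: (@ck_ext _ _ _ (cst 0)); last exact: ck_cst.
  rewrite (_ : [set x : R | _] = `]-oo, n.+1%:R^-1[); first exact: interval_open.
  by apply/seteqP; split => x /=; rewrite in_itv.
by move=> x /= xn; rewrite near0_cutoff0 ?mulr0// ltW.
Qed.

Lemma smooth_measurable f : smooth pos f -> measurable_fun pos f.
Proof.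
move=> sf; apply: open_continuous_measurable_fun; first exact: open_pos.
by move=> x /[!inE] px; exact: smooth_continuous sf _ px.
Qed.

Lemma smoothT_pos f : smooth setT f -> smooth pos f.
Proof. by move=> sf k; exact: ckS (sf k). Qed.

End truncation.

Section transform.
Context {R : realType}.
Local Notation pos := (`]0%R, +oo[%classic : set R).
Variables (b : R) (u : R -> probability R R).
Hypothesis b02 : 0 < b <= 2.
Hypothesis diffu : fractional_diffusion b u.
Hypothesis upos : forall t, 0 < t -> u t pos = (2^-1)%:E.
Implicit Types (f g phi psi : R -> R) (s t C : R).
Local Notation hexp := (hexp u).

Lemma test_hexp_continuous phi t : test_function phi ->
  (forall x, x <= 0 -> phi x = 0) -> 0 < t -> {for t, continuous (hexp phi)}.
Proof.
move=> tphi phi0 t0.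
have -> : hexp phi = fun t => 2 * \int[u t]_x phi x.
  by apply/funext => r; exact: hexp_test.
by apply: cvgM; [exact: cvg_cst|exact: (test_mean_continuous b02)].
Qed.

Definition cut n f x := f x * near0_cutoff n x * infty_cutoff n x.

Lemma cut_test n f : smooth pos f -> test_function (cut n f).
Proof.
move=> sf; apply: (@smooth_test_function _ _ n.+1%:R).
- move=> k; apply: ckM; [exact: openT|exact: smooth_cut_near0|].
  exact: smooth_infty_cutoff.
- by move=> x x0; rewrite /cut near0_cutoff0 ?mulr0 ?mul0r// (le_trans x0).
- by move=> x xn; rewrite /cut infty_cutoff0 ?mulr0// ltW.
Qed.

Lemma cut0 n f x : x <= 0 -> cut n f x = 0.
Proof. by move=> x0; rewrite /cut near0_cutoff0 ?mulr0 ?mul0r// (le_trans x0). Qed.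

Lemma cut_norm n f x : `|cut n f x| <= `|f x|.
Proof.
rewrite /cut !normrM -mulrA ler_piMr// mulr_ile1//; exact: cutoff_norm.
Qed.

Lemma cut_cvg f x : 0 < x -> cut n f x @[n --> \oo] --> f x.
Proof.
move=> x0; rewrite -[X in _ --> X](mulr1 (f x)) -[X in _ --> X](mulr1 (f x * 1)).
apply: cvgM; last exact: cvg_infty_cutoff.
by apply: cvgM; [exact: cvg_cst|exact: cvg_near0_cutoff].
Qed.

(** Vague continuity on the open half line is part of the diffusion equation. No mass
    escapes to the origin or to infinity, because the total folded mass is [1] at every time:
    the mass lost by truncation at a nearby time is controlled by the mass lost at [t]. *)
Lemma hexp_continuous f C t : smooth pos f -> (forall x, 0 < x -> `|f x| <= C) ->
  0 < t -> {for t, continuous (hexp f)}.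
Proof.
move=> sf fC t0.
have s1 : smooth pos (cst (1 : R)) by move=> k; exact: ck_cst.
have C0 : 0 <= C by exact: le_trans (fC 1 ltr01).
have C1 : 0 < C + 1 by rewrite ltr_wpDl.
pose k n := cut n (cst 1).
have mk n : measurable_fun pos (k n).
  exact: measurable_funTS (test_measurable (cut_test n s1)).
have k1 n x : `|k n x| <= 1 by rewrite (le_trans (cut_norm _ _ _))// normr1.
have k01 n x : 0 <= k n x <= 1.
  rewrite /k/cut/= mul1r; apply/andP; split.
    by rewrite mulr_ge0//; exact: cutoff_ge0.
  by rewrite mulr_ile1//; do ?exact: cutoff_ge0; exact: cutoff_le1.
have mf := smooth_measurable sf.
have mfk n : measurable_fun pos (cut n f).
  exact: measurable_funTS (test_measurable (cut_test n sf)).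
(* truncation costs at most [C] times the mass that the cutoffs remove *)
have tail n r : 0 < r -> `|hexp f r - hexp (cut n f) r| <= C * (1 - hexp (k n) r).
  move=> r0; have bf : bounded_on pos f.
    by exists C => x; rewrite /= in_itv/= andbT => /fC.
  have bk : bounded_on pos (k n) by exists 1 => x _; exact: k1.
  have bc : bounded_on pos (cut n f).
    by exists C => x; rewrite /= in_itv/= andbT => /fC; apply: le_trans (cut_norm _ _ _).
  have bN g : bounded_on pos g -> bounded_on pos (fun x => - 1 * g x).
    by move=> [D gD]; exists D => x /gD; rewrite mulN1r normrN.
  have mN g : measurable_fun pos g -> measurable_fun pos (fun x => - 1 * g x).
    by move=> mg; exact: measurable_funM.
  have b1 : bounded_on pos (cst (1 : R)) by exists 1 => x _ /=; rewrite normr1.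
  have E1 : hexp f r - hexp (cut n f) r = hexp (fun x => f x + - 1 * cut n f x) r.
    by rewrite hexpD ?hexpZ ?mulN1r//; [exact: mN|exact: bN].
  have E2 : 1 - hexp (k n) r = hexp (fun x => 1 + - 1 * k n x) r.
    rewrite (@hexpD R u (cst 1) (fun x => - 1 * k n x) r)//;
      [by rewrite hexpZ// mulN1r hexp_cst|exact: mN|exact: bN].
  have m2 : measurable_fun pos (fun x => 1 + - 1 * k n x).
    by apply: measurable_funD => //; exact: mN.
  have b2 : bounded_on pos (fun x => 1 + - 1 * k n x).
    by exists 1 => x _; have /andP[? ?] := k01 n x; rewrite ler_norml; lra.
  rewrite E1 E2 -hexpZ//; apply: hexp_norm_le => //.
  - by apply: measurable_funD => //; exact: mN.
  - exact: measurable_funM.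
  - by case: b2 => D hD; exists (C * D) => x /hD; rewrite normrM ger0_norm// => ?;
      rewrite ler_wpM2l.
  - move=> x x0; rewrite (_ : _ + _ = f x * (1 + - 1 * k n x)).
      have /andP[? ?] := k01 n x.
      rewrite normrM (@ger0_norm _ (1 + _)) ?ler_wpM2r ?fC//; lra.
    by rewrite /k /cut/=; ring.
apply/cvgrPdist_lt => /= e e0.
pose del := e / (4 * (C + 1)).
have del0 : 0 < del by rewrite divr_gt0// mulr_gt0.
have delC : del * (C + 1) = e / 4 by rewrite /del; field; rewrite gt_eqF.
have cvk : hexp (k n) t @[n --> \oo] --> (1 : R).
  rewrite -(hexp_cst upos 1 t0); apply: (@hexp_cvg R u k (cst 1) 1 t) => //.
  by move=> x x0; exact: cut_cvg.
have /cvgrPdist_lt /(_ _ del0)[n _ /(_ n (leqnn n))/= kn] := cvk.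
have ck : {for t, continuous (hexp (k n))}.
  by apply: test_hexp_continuous => //; [exact: cut_test|move=> x; exact: cut0].
have cf : {for t, continuous (hexp (cut n f))}.
  by apply: test_hexp_continuous => //; [exact: cut_test|move=> x; exact: cut0].
have e4 : 0 < e / 4 by rewrite divr_gt0.
near=> r.
have r0 : 0 < r by near: r; exact: lt_nbhsr.
have h1 : `|hexp (k n) t - hexp (k n) r| < del.
  by near: r; move/cvgrPdist_lt : ck; apply.
have h2 : `|hexp (cut n f) t - hexp (cut n f) r| < e / 4.
  by near: r; move/cvgrPdist_lt : cf; apply.
have t1 := tail n t t0; have t2 := tail n r r0.
have k1t : 1 - hexp (k n) t < del by exact: le_lt_trans (ler_norm _) kn.
have k1r : 1 - hexp (k n) r < 2 * del.
  have := le_lt_trans (ler_norm _) h1; lra.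
have t1' : `|hexp f t - hexp (cut n f) t| <= (C + 1) * del.
  apply: (le_trans t1); apply: ler_pM; rewrite ?(ltW k1t)// ?lerDl//.
  by rewrite subr_ge0 -(hexp_cst upos 1 t0) (le_trans (ler_norm _))// hexp_norm// hexp_cst.
have t2' : `|hexp f r - hexp (cut n f) r| <= (C + 1) * (2 * del).
  apply: (le_trans t2); apply: ler_pM; rewrite ?(ltW k1r)// ?lerDl//.
  by rewrite subr_ge0 (le_trans (ler_norm _))// hexp_norm.
rewrite (_ : hexp f t - hexp f r = (hexp f t - hexp (cut n f) t) +
  (hexp (cut n f) t - hexp (cut n f) r) - (hexp f r - hexp (cut n f) r)); last by ring.
apply: (le_lt_trans (ler_normB _ _)); apply: (@le_lt_trans _ _
  ((C + 1) * del + `|hexp (cut n f) t - hexp (cut n f) r| + (C + 1) * (2 * del))).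
  by rewrite lerD// (le_trans (ler_normD _ _))// lerD.
rewrite (mulrCA _ 2) (mulrC (C + 1)) delC; lra.
Unshelve. all: by end_near. Qed.

End transform.

(** * The second order identity for the transformed diffusion *)

Section derivation_rules.
Context {R : realType}.
Implicit Types (f g : R -> R) (D : set R).

Lemma derive1M f g x : derivable f x 1 -> derivable g x 1 ->
  derive1 (fun x => f x * g x) x = derive1 f x * g x + f x * derive1 g x.
Proof.
move=> df dg; rewrite !derive1E (deriveM df dg) /GRing.scale/= addrC.
by congr (_ + _); exact: mulrC.
Qed.

Lemma derive1D f g x : derivable f x 1 -> derivable g x 1 ->
  derive1 (fun x => f x + g x) x = derive1 f x + derive1 g x.
Proof. by move=> df dg; rewrite !derive1E (deriveD df dg). Qed.

Lemma smoothM D f g : open D -> smooth D f -> smooth D g ->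
  smooth D (fun x => f x * g x).
Proof. by move=> oD sf sg k; exact: ckM. Qed.

Lemma smoothD D f g : open D -> smooth D f -> smooth D g ->
  smooth D (fun x => f x + g x).
Proof. by move=> oD sf sg k; exact: ckD. Qed.

Lemma smoothZ D c f : open D -> smooth D f -> smooth D (fun x => c * f x).
Proof. by move=> oD sf k; exact: ckZ. Qed.

Lemma derive1_derive1M f g : smooth setT f -> smooth setT g ->
  derive1 (derive1 (fun x => f x * g x)) = fun x =>
    derive1 (derive1 f) x * g x + 2 * (derive1 f x * derive1 g x) +
    f x * derive1 (derive1 g) x.
Proof.
move=> sf sg; have df x := smooth_derivable sf (I : setT x).
have dg x := smooth_derivable sg (I : setT x).
have df' x := smooth_derivable (smooth_derive1 sf) (I : setT x).
have dg' x := smooth_derivable (smooth_derive1 sg) (I : setT x).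
have -> : derive1 (fun x => f x * g x) =
    fun x => derive1 f x * g x + f x * derive1 g x.
  by apply/funext => x; rewrite derive1M.
apply/funext => x; rewrite derive1D; [|exact: derivableM|exact: derivableM].
rewrite (derive1M (df' x) (dg x)) (derive1M (df x) (dg' x)).
move: (derive1 (derive1 f) x) (derive1 (derive1 g) x) (derive1 f x) (derive1 g x).
by move=> f2 g2 f1 g1; move: (f x) (g x) => f0 g0; ring.
Qed.

End derivation_rules.

Lemma cvgMr_cst {R : realType} (v : nat -> R) (l c : R) :
  v n @[n --> \oo] --> l -> c * v n @[n --> \oo] --> c * l.
Proof. by move=> vl; apply: cvgM => //; exact: cvg_cst. Qed.

Section transform.
Context {R : realType}.
Local Notation leb := (@lebesgue_measure R).
Local Notation pos := (`]0%R, +oo[%classic : set R).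
Variables (b : R) (u : R -> probability R R).
Hypothesis b02 : 0 < b <= 2.
Hypothesis diffu : fractional_diffusion b u.
Hypothesis upos : forall t, 0 < t -> u t pos = (2^-1)%:E.
Implicit Types (f g phi psi : R -> R) (s t C : R).
Local Notation hexp := (hexp u).

Definition bounded_smooth f := smooth pos f /\ bounded_on pos f.

Lemma bounded_onP f C : (forall x, 0 < x -> `|f x| <= C) -> bounded_on pos f.
Proof. by move=> fC; exists C => x; rewrite /= in_itv/= andbT => /fC. Qed.

Lemma bounded_onE f : bounded_on pos f ->
  exists2 C, 0 <= C & forall x, 0 < x -> `|f x| <= C.
Proof.
move=> [C fC]; exists `|C| => // x x0.
by rewrite (le_trans _ (ler_norm _))// fC//= in_itv/= x0.
Qed.

Lemma bounded_onD D f g : bounded_on D f -> bounded_on D g ->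
  bounded_on D (fun x => f x + g x).
Proof.
move=> [C fC] [C' gC]; exists (C + C') => x Dx.
by rewrite (le_trans (ler_normD _ _))// lerD ?fC ?gC.
Qed.

Lemma bounded_onM D f g : bounded_on D f -> bounded_on D g ->
  bounded_on D (fun x => f x * g x).
Proof.
move=> [C fC] [C' gC]; exists (C * C') => x Dx.
by rewrite normrM ler_pM ?fC ?gC.
Qed.

Lemma bounded_on_cst (D : set R) c : bounded_on D (cst c).
Proof. by exists `|c| => x _. Qed.

Lemma bounded_smoothD f g : bounded_smooth f -> bounded_smooth g ->
  bounded_smooth (fun x => f x + g x).
Proof.
by move=> [sf bf] [sg bg]; split; [exact: smoothD open_pos _ _|exact: bounded_onD].
Qed.

Lemma bounded_smooth_cst c : bounded_smooth (cst c).
Proof. by split; [move=> k; exact: ck_cst|exact: bounded_on_cst]. Qed.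

Lemma bounded_smoothM f g : bounded_smooth f -> bounded_smooth g ->
  bounded_smooth (fun x => f x * g x).
Proof.
by move=> [sf bf] [sg bg]; split; [exact: smoothM open_pos _ _|exact: bounded_onM].
Qed.

Lemma bounded_smoothZ c f : bounded_smooth f -> bounded_smooth (fun x => c * f x).
Proof. by move=> bf; apply: bounded_smoothM => //; exact: bounded_smooth_cst. Qed.

Lemma hexp_measurable f : bounded_smooth f -> measurable_fun pos (hexp f).
Proof.
move=> [sf /bounded_onE[C _ fC]].
apply: open_continuous_measurable_fun; first exact: open_pos.
move=> x; rewrite inE/= in_itv/= andbT => x0.
exact: (hexp_continuous b02 diffu upos sf fC).
Qed.

Lemma lap_integrable_hexp f s : bounded_smooth f -> 0 < s -> lap_integrable (hexp f) s.
Proof.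
move=> bf s0; have [sf /bounded_onE[C _ fC]] := bf.
apply: (@bounded_lap_integrable _ _ _ C) => //; first exact: hexp_measurable.
by move=> t t0; apply: hexp_norm => //; exact: smooth_measurable.
Qed.

Lemma lap_hexpD f g s : bounded_smooth f -> bounded_smooth g -> 0 < s ->
  lap (hexp (fun x => f x + g x)) s = lap (hexp f) s + lap (hexp g) s.
Proof.
move=> bf bg s0.
have [_ <-] := lapD (lap_integrable_hexp bf s0) (lap_integrable_hexp bg s0).
have [sf bf'] := bf; have [sg bg'] := bg.
by apply: eq_lap => t t0; rewrite hexpD//; exact: smooth_measurable.
Qed.

Lemma lap_hexpZ c f s : bounded_smooth f -> 0 < s ->
  lap (hexp (fun x => c * f x)) s = c * lap (hexp f) s.
Proof.
move=> bf s0; have [_ <-] := lapZ c (lap_integrable_hexp bf s0).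
have [sf bf'] := bf.
by apply: eq_lap => t t0; rewrite hexpZ//; exact: smooth_measurable.
Qed.

Lemma lap_hexp_cst c s : 0 < s -> lap (hexp (cst c)) s = c / s.
Proof.
move=> s0; have [i1 <-] := lap_cst1 s0; have [_ <-] := lapZ c i1.
by apply: eq_lap => t t0; rewrite hexp_cst//= mulr1.
Qed.

(** The functional is bounded, so bounded pointwise convergence passes through the mean and
    then through the transform. *)
Lemma lap_hexp_cvg (f_ : nat -> R -> R) f C s : 0 < s ->
  (forall n, smooth pos (f_ n)) -> (forall n x, 0 < x -> `|f_ n x| <= C) ->
  (forall x, 0 < x -> f_ n x @[n --> \oo] --> f x) ->
  lap (hexp (f_ n)) s @[n --> \oo] --> lap (hexp f) s.
Proof.
move=> s0 sf fC fcv; have [i1 _] := lap_cst1 s0.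
have [|||||//] := @Rintegral_dominated R _ _ leb pos _
  (fun n t => expR (- (s * t)) * hexp (f_ n) t)
  (fun t => expR (- (s * t)) * hexp f t)
  (fun t => C * (expR (- (s * t)) * 1)).
- by [].
- move=> n; apply: measurable_funM; first exact: measurable_expsM.
  by apply: hexp_measurable; split => //; exact: bounded_onP (fC n).
- move=> t; rewrite /= in_itv/= andbT => t0; apply: cvgM; first exact: cvg_cst.
  by apply: (@hexp_cvg R u f_ f C t) => // n; exact: smooth_measurable.
- exact: integrable_scale.
- move=> n t; rewrite /= in_itv/= andbT => t0.
  rewrite normrM ger0_norm ?expR_ge0// mulr1 mulrC ler_wpM2r ?expR_ge0//.
  by apply: hexp_norm => //; [exact: smooth_measurable|exact: fC].
Qed.

(** As [phi] vanishes on the negative half line, so does its second derivative, and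
    both means over the half line are twice the means over the line. *)
Lemma lap_hexp_test phi s : test_function phi -> (forall x, x <= 0 -> phi x = 0) ->
  0 < s ->
  lap (hexp (derive1 (derive1 phi))) s = s `^ b * lap (hexp phi) s.
Proof.
move=> tphi phi0 s0.
have := lap_test_mean b02 diffu tphi (phi0 0 (lexx 0)) s0.
have phi0' f : test_function f -> (forall x, x <= 0 -> f x = 0) ->
    forall x, x <= 0 -> derive1 f x = 0.
  move=> tf f0 x; have sf : smooth setT f by apply/smooth_test; case: tf.
  have cf' : {for 0, continuous (derive1 f)}.
    by apply: (smooth_continuous (D := setT)) => //; exact: smooth_derive1.
  have neg y : y < 0 -> derive1 f y = 0.
    move=> y0; rewrite -[RHS](derive1_cst (0 : R) y).
    apply: (@eq_on_derive1 R [set z | z < 0]) => //.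
    by move=> z /= z0; rewrite f0// ltW.
  rewrite le_eqVlt => /predU1P[->|/neg//].
  have cv1 : derive1 f y @[y --> 0^'-] --> derive1 f 0 by exact: cvg_at_left_filter.
  have cv2 : derive1 f y @[y --> 0^'-] --> (0 : R).
    by apply: cvg_near_cst; near=> y; rewrite neg//; near: y; exact: nbhs_left_lt.
  exact: cvg_unique cv1 cv2.
have t1 := test_derive1 tphi; have z1 := phi0' _ tphi phi0.
have t2 := test_derive1 t1; have z2 := phi0' _ t1 z1.
move=> E; transitivity (2 * lap (fun t => \int[u t]_x derive1 (derive1 phi) x) s).
  rewrite -(proj2 (lapZ _ _)).
    by apply: eq_lap => t t0; exact: hexp_test.
  have [C C0 hC] := test_bounded t2.
  apply: (@bounded_lap_integrable _ _ _ C) => //.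
    exact: test_mean_measurable b02 diffu _ t2.
  by move=> t t0; apply: test_mean_norm hC _; exact: test_measurable.
rewrite E mulrCA; congr (_ * _).
rewrite -(proj2 (lapZ _ _)).
  by apply: eq_lap => t t0; rewrite hexp_test.
have [C C0 hC] := test_bounded tphi.
apply: (@bounded_lap_integrable _ _ _ C) => //.
  exact: test_mean_measurable b02 diffu _ tphi.
by move=> t t0; apply: test_mean_norm hC _; exact: test_measurable.
Unshelve. all: by end_near. Qed.

(** Cut [phi] off at infinity: in the product rule the terms with a derivative of the
    cutoff tend to [0] boundedly. *)
Lemma lap_hexp_derive2 phi s : smooth setT phi -> (forall x, x <= 0 -> phi x = 0) ->
  bounded_on pos phi -> bounded_on pos (derive1 phi) ->
  bounded_on pos (derive1 (derive1 phi)) -> 0 < s ->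
  lap (hexp (derive1 (derive1 phi))) s = s `^ b * lap (hexp phi) s.
Proof.
move=> sphi phi0 /bounded_onE[C C0 hC] /bounded_onE[C1 C10 hC1]
  /bounded_onE[C2 C20 hC2] s0.
pose k n := infty_cutoff n : R -> R.
have sk n : smooth setT (k n) by exact: smooth_infty_cutoff.
pose P1 : {poly R} := flat_deriv 1; pose P2 := flat_deriv P1.
have k'E n : derive1 (k n) = fun x => - flat P1 (n.+1%:R - x).
  exact: derive1_flat_shift.
have k''E n : derive1 (derive1 (k n)) = fun x => flat P2 (n.+1%:R - x).
  rewrite k'E; apply/funext => x.
  rewrite (_ : (fun x => - flat P1 (n.+1%:R - x)) =
      (fun x => cst (-1) x * flat P1 (n.+1%:R - x))); last first.
    by apply/funext => y; rewrite mulN1r.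
  have sf : smooth setT (fun x : R => flat P1 (n.+1%:R - x)).
    rewrite (_ : (fun x => _) = fun x => flat P1 (- 1 * x + n.+1%:R)); last first.
      by apply/funext => y; rewrite mulN1r addrC.
    move=> j; apply: (@ck_affine R j setT setT) => //; first exact: openT.
    exact: smooth_flat.
  rewrite derive1M ?derive1_cst ?mul0r ?add0r//; last exact: (smooth_derivable sf).
  by rewrite derive1_flat_shift mulN1r opprK.
have [D1 D10 hD1] := flat_bounded P1; have [D2 D20 hD2] := flat_bounded P2.
pose phin n x := phi x * k n x.
have sphin n : smooth setT (phin n) by exact: smoothM openT sphi (sk n).
have tphin n : test_function (phin n).
  apply: (@smooth_test_function _ _ n.+1%:R) => //.
  - by move=> x x0; rewrite /phin phi0// mul0r.
  - by move=> x xn; rewrite /phin /k infty_cutoff0 ?mulr0// ltW.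
have En n : lap (hexp (derive1 (derive1 (phin n)))) s = s `^ b * lap (hexp (phin n)) s.
  by apply: lap_hexp_test => // x x0; rewrite /phin phi0// mul0r.
have cv1 : lap (hexp (phin n)) s @[n --> \oo] --> lap (hexp phi) s.
  apply: (@lap_hexp_cvg _ _ C) => //.
  - by move=> n; exact: smoothT_pos.
  - by move=> n x x0; rewrite normrM (le_trans _ (hC x x0))// ler_piMr// cutoff_norm.
  - move=> x x0; rewrite -[X in _ --> X]mulr1; apply: cvgM; first exact: cvg_cst.
    exact: cvg_infty_cutoff.
have P10 : P1.[0] = 0 by rewrite /P1 /flat_deriv hornerM hornerX mul0r.
have P20 : P2.[0] = 0 by rewrite /P2 /flat_deriv hornerM hornerX mul0r.
have E'' n x : derive1 (derive1 (phin n)) x = derive1 (derive1 phi) x * k n x +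
    2 * (derive1 phi x * - flat P1 (n.+1%:R - x)) + phi x * flat P2 (n.+1%:R - x).
  by rewrite derive1_derive1M// k''E k'E.
have cv2 : lap (hexp (derive1 (derive1 (phin n)))) s @[n --> \oo] -->
    lap (hexp (derive1 (derive1 phi))) s.
  apply: (@lap_hexp_cvg _ _ (C2 + 2 * (C1 * D1) + C * D2)) => //.
  - by move=> n; apply: smoothT_pos; do 2 apply: smooth_derive1.
  - move=> n x x0; rewrite E''.
    rewrite (le_trans (ler_normD _ _))// lerD//; last first.
      by rewrite normrM ler_pM// hC.
    rewrite (le_trans (ler_normD _ _))// lerD//.
      by rewrite normrM (le_trans _ (hC2 x x0))// ler_piMr// cutoff_norm.
    rewrite normrM ger0_norm// ler_wpM2l// normrM normrN ler_pM// hC1//.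
  - move=> x x0; under eq_fun do rewrite E''.
    have c1 : flat P1 (n.+1%:R - x) @[n --> \oo] --> (0 : R).
      by have := @flat_cvg_infty R P1 x; rewrite P10.
    have c2 : flat P2 (n.+1%:R - x) @[n --> \oo] --> (0 : R).
      by have := @flat_cvg_infty R P2 x; rewrite P20.
    have c0 : k n x @[n --> \oo] --> (1 : R) by exact: cvg_infty_cutoff.
    have d0 := cvgMr_cst (c := derive1 (derive1 phi) x) c0.
    have cN : - flat P1 (n.+1%:R - x) @[n --> \oo] --> (- 0 : R) by exact: cvgN.
    have d1 := cvgMr_cst (c := 2) (cvgMr_cst (c := derive1 phi x) cN).
    have := cvgD (cvgD d0 d1) (cvgMr_cst (c := phi x) c2).
    by rewrite mulr1 oppr0 !mulr0 !addr0 => h; exact: h.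
have cv3 : s `^ b * lap (hexp (phin n)) s @[n --> \oo] --> s `^ b * lap (hexp phi) s.
  exact: (cvgMr_cst (c := s `^ b) cv1).
apply: (@cvg_unique _ _ _ _ _ _ cv2) => //.
rewrite (_ : (fun n => _) = (fun n => s `^ b * lap (hexp (phin n)) s))//.
by apply/funext => n; rewrite En.
Unshelve. all: by end_near. Qed.

End transform.

(** * From the second order identity to a first order one *)

Section first_order_equation.
Context {R : realType}.
Local Notation leb := (@lebesgue_measure R).
Local Notation pos := (`]0%R, +oo[%classic : set R).
Variables (r : R) (psi : R -> R).
Hypotheses (r0 : 0 < r) (spsi : smooth setT psi).
Hypothesis psi0 : forall x, x <= 0 -> psi x = 0.

Lemma is_derive_expRM (c x : R) : is_derive x (1 : R) (fun x => expR (c * x)) (c * expR (c * x)).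
Proof.
have dg : is_derive x (1 : R) (fun x : R => c * x) c.
  have -> : (fun x => c * x) = c \*: (@id R) by [].
  by apply: is_derive_eq; rewrite /GRing.scale/= mulr1.
have dE := is_derive_expR (c * x).
by have := @is_derive1_comp R expR (fun x => c * x) x _ _ dE dg; rewrite mulrC.
Qed.

Let f (x : R) := expR (r * x) * psi x.
Let F (x : R) := \int[leb]_(y in `[-1, x]) f y.

(** The solution of [phi' + r * phi = psi] that vanishes on the negative half line. The
    integral may start at any negative number; [-1] leaves room to differentiate at the origin. *)
Definition decay_solution (x : R) := expR (- r * x) * F x.

Let cf : continuous f.
Proof.
move=> x; have h : {for x, continuous (fun y => expR (r * y))}.
  apply: differentiable_continuous; apply/derivable1_diffP.
  exact: (ex_derive (is_derive := is_derive_expRM r x)).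
by apply: cvgM; [exact: h|exact: (smooth_continuous spsi)].
Qed.

Let F0 x : x <= 0 -> F x = 0.
Proof.
move=> x0; rewrite /F -(Rintegral_set0 leb f) [LHS]Rintegral_mkcond [RHS]Rintegral_mkcond.
apply: eq_Rintegral => y _; rewrite !patchE in_set0.
case: ifPn => //; rewrite inE/= in_itv/= => /andP[_ yx].
by rewrite /f psi0 ?mulr0// (le_trans yx).
Qed.

Let dF x : is_derive x (1 : R) F (f x).
Proof.
have [x0|x0] := ltP x 0.
  rewrite /f psi0 ?mulr0 ?ltW//; apply: (near_eq_is_derive (f := cst 0)) => //.
  by near=> y; rewrite F0// ltW//; near: y; exact: lt_nbhsl.
have x1 : -1 < x by lra.
have xx : x < x + 1 by lra.
have i1 : leb.-integrable `[-1, x + 1] (EFin \o f).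
  apply: continuous_compact_integrable; first exact: segment_compact.
  exact: continuous_subspaceT.
have [dF dFE] := continuous_FTC1_closed xx i1 x1 (@cf x).
by have := derivableP dF; rewrite -derive1E dFE.
Unshelve. all: by end_near. Qed.

Lemma decay_solution0 x : x <= 0 -> decay_solution x = 0.
Proof. by move=> x0; rewrite /decay_solution F0// mulr0. Qed.

Lemma is_derive_decay_solution x :
  is_derive x (1 : R) decay_solution (psi x + - r * decay_solution x).
Proof.
have dE := is_derive_expRM (- r) x; have dFx := dF x.
have -> : decay_solution = (fun x => expR (- r * x)) * F by [].
have EE : expR (- r * x) * expR (r * x) = 1 by rewrite -expRD mulNr addNr expR0.
apply: is_derive_eq; rewrite /GRing.scale/= {1}/f mulrA EE mul1r /decay_solution.
by congr (_ + _); rewrite -[RHS]/(- r * (expR (- r * x) * F x)); ring.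
Qed.

Lemma smooth_decay_solution : smooth setT decay_solution.
Proof.
apply: (smooth_ode (g := psi) (c := - r)) => //; first exact: openT.
by move=> x _; exact: is_derive_decay_solution.
Qed.

Lemma derive1_decay_solution x :
  derive1 decay_solution x = psi x + - r * decay_solution x.
Proof. exact: (derive1_val (is_derive_decay_solution x)). Qed.

(** If [psi] is bounded by [C], then [C / r * expR (r * y) - e * F y] is nondecreasing
    for [e = 1] and [e = -1] and nonnegative at the origin. *)
Lemma decay_solution_bounded : bounded_on pos psi -> bounded_on pos decay_solution.
Proof.
move=> /bounded_onE[C C0 hC]; apply: (bounded_onP (C := C / r)) => x x0.
have key (e : R) : `|e| = 1 -> e * F x <= C / r * expR (r * x).
  move=> e1; pose G y := C / r * expR (r * y) - e * F y.
  have dG y : is_derive y (1 : R) G (expR (r * y) * (C - e * psi y)).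
    have dE := is_derive_expRM r y; have dFx := dF y.
    have -> : G = ((C / r) \*: (fun y => expR (r * y))) - (e \*: F) by [].
    apply: is_derive_eq; rewrite /GRing.scale/= /f; field; exact: lt0r_neq0.
  have cG : {within `[0, x], continuous G}.
    apply: continuous_subspaceT => y; apply: differentiable_continuous.
    by apply/derivable1_diffP; exact: (ex_derive (is_derive := dG y)).
  have [c cx GE] := MVT_segment (ltW x0) (fun y _ => dG y) cG.
  have : G 0 <= G x.
    rewrite -subr_ge0 GE mulr_ge0 ?subr_ge0 ?(ltW x0)// mulr_ge0 ?expR_ge0//.
    rewrite subr_ge0 (le_trans (ler_norm _))// normrM e1 mul1r.
    by have [c0|c0] := leP c 0; [rewrite psi0// normr0|exact: hC].
  rewrite {1}/G F0// mulr0 mulr0 expR0 subr0 mulr1 => h.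
  rewrite -subr_ge0; apply: le_trans h.
  by rewrite divr_ge0// ltW.
have e0 := expR_gt0 (- r * x).
have EE : expR (- r * x) * expR (r * x) = 1 by rewrite -expRD mulNr addNr expR0.
rewrite /decay_solution normrM ger0_norm ?expR_ge0//.
rewrite -(ler_pM2l (expR_gt0 (r * x))) mulrA (mulrC (expR (r * x))) EE mul1r.
rewrite mulrC ler_norml; apply/andP; split.
  by rewrite lerNl -mulN1r key// normrN1.
by rewrite -[leLHS]mul1r key// normr1.
Qed.

End first_order_equation.

Section transform.
Context {R : realType}.
Local Notation leb := (@lebesgue_measure R).
Local Notation pos := (`]0%R, +oo[%classic : set R).
Variables (b : R) (u : R -> probability R R).
Hypothesis b02 : 0 < b <= 2.
Hypothesis diffu : fractional_diffusion b u.
Hypothesis upos : forall t, 0 < t -> u t pos = (2^-1)%:E.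
Implicit Types (f g phi psi : R -> R) (s t C : R).
Local Notation hexp := (hexp u).

(** The elimination step: with [x], [y], [z] the transforms for [phi], [psi] and [psi']. *)
Lemma factor_second_order (x y z c r w1 w2 : R) : w2 = c * x -> c = r ^+ 2 ->
  w1 = y + - r * x -> w2 = z + - r * w1 -> z = r * y.
Proof.
move=> h0 hc h1 h2; have h : z + - r * (y + - r * x) = r ^+ 2 * x.
  by rewrite -h1 -h2 h0 hc.
by rewrite -[LHS](addrK (- r * (y + - r * x))) h; ring.
Qed.

(** For the solution [phi] of [phi' + r * phi = psi] one has
    [phi'' = psi' - r * psi + r ^+ 2 * phi]; the second order identity for [phi] leaves
    [L psi' - r * L psi = 0]. *)
Lemma lap_hexp_derive1_flat psi r s : smooth setT psi ->
  (forall x, x <= 0 -> psi x = 0) ->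
  bounded_on pos psi -> bounded_on pos (derive1 psi) -> 0 < s -> 0 < r ->
  s `^ b = r ^+ 2 ->
  lap (hexp (derive1 psi)) s = r * lap (hexp psi) s.
Proof.
move=> spsi psi0 bpsi bpsi' s0 r0 sr.
pose phi := decay_solution r psi.
have sphi : smooth setT phi by exact: smooth_decay_solution.
have bphi : bounded_on pos phi by exact: decay_solution_bounded.
have bsphi : bounded_smooth phi by split => //; exact: smoothT_pos.
have bspsi : bounded_smooth psi by split => //; exact: smoothT_pos.
have bspsi' : bounded_smooth (derive1 psi).
  by split => //; apply: smoothT_pos; exact: smooth_derive1.
have phi'E : derive1 phi = fun x => psi x + - r * phi x.
  by apply/funext => x; exact: derive1_decay_solution.
have bphi' : bounded_smooth (derive1 phi).
  by rewrite phi'E; apply: bounded_smoothD => //; exact: bounded_smoothZ.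
have phi''E : derive1 (derive1 phi) = fun x => derive1 psi x + - r * derive1 phi x.
  rewrite [in LHS]phi'E; apply/funext => x.
  have dphi : derivable phi x 1 by exact: smooth_derivable sphi _ _.
  have dpsi : derivable psi x 1 by exact: smooth_derivable spsi _ _.
  have drphi := smooth_derivable (smoothZ (- r) openT sphi) (I : setT x).
  rewrite (derive1D dpsi drphi) (derive1M (derivable_cst (- r) x 1) dphi).
  by rewrite derive1_cst mul0r add0r.
have bphi'' : bounded_smooth (derive1 (derive1 phi)).
  by rewrite phi''E; apply: bounded_smoothD => //; exact: bounded_smoothZ.
have e0 := lap_hexp_derive2 b02 diffu upos sphi (decay_solution0 r psi0) bphi
  (proj2 bphi') (proj2 bphi'') s0.
have e1 : lap (hexp (derive1 phi)) s = lap (hexp psi) s + - r * lap (hexp phi) s.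
  rewrite phi'E (lap_hexpD b02 diffu upos bspsi (bounded_smoothZ (- r) bsphi) s0).
  by congr (_ + _); exact: (lap_hexpZ b02 diffu upos (- r) bsphi s0).
have e2 : lap (hexp (derive1 (derive1 phi))) s =
    lap (hexp (derive1 psi)) s + - r * lap (hexp (derive1 phi)) s.
  rewrite phi''E.
  rewrite (lap_hexpD b02 diffu upos bspsi' (bounded_smoothZ (- r) bphi') s0).
  by congr (_ + _); exact: (lap_hexpZ b02 diffu upos (- r) bphi' s0).
exact: (factor_second_order e0 sr e1 e2).
Qed.

(** Apply the first order identity to [f - f0] cut off near the origin. The derivative of
    the cutoff is of order [n] on a region of width [1 / n], where [f - f0] is of order [1 / n]:
    this term stays bounded and tends to [0] pointwise. *)
Lemma lap_hexp_derive1 f (f0 K r : R) s : bounded_smooth f -> bounded_smooth (derive1 f) ->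
  (forall x, 0 < x -> `|f x - f0| <= K * x) -> 0 < s -> 0 < r -> s `^ b = r ^+ 2 ->
  lap (hexp (derive1 f)) s = r * (lap (hexp f) s - f0 / s).
Proof.
move=> bf bf' fK s0 r0 sr.
pose g x := f x + cst (- f0) x.
have bg : bounded_smooth g by apply: bounded_smoothD => //; exact: bounded_smooth_cst.
have g'E x : 0 < x -> derive1 g x = derive1 f x.
  move=> x0; rewrite derive1D ?derive1_cst ?addr0//.
  by apply: smooth_derivable (proj1 bf) _ _; rewrite /= in_itv/= x0.
have -> : lap (hexp (derive1 f)) s = lap (hexp (derive1 g)) s.
  by apply: eq_lap => t t0; apply: eq_hexp => x x0; rewrite g'E.
have <- : lap (hexp g) s = lap (hexp f) s - f0 / s.
  rewrite (lap_hexpD b02 diffu upos)//; last exact: bounded_smooth_cst.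
  by rewrite lap_hexp_cst// mulNr.
have [_ /bounded_onE[C C0 hC]] := bg.
have bg' : bounded_smooth (derive1 g).
  split; first by apply: smooth_derive1; case: bg.
  have [_ /bounded_onE[C' C'0 hC']] := bf'.
  by apply: (bounded_onP (C := C')) => x x0; rewrite g'E// hC'.
have [sg' /bounded_onE[C' C'0 hC']] := bg'.
have sg : smooth pos g by case: bg.
have gK x : 0 < x -> `|g x| <= K * x by exact: fK.
have K0 : 0 <= K by have := le_trans (normr_ge0 _) (gK 1 ltr01); rewrite mulr1.
pose P0 : {poly R} := 'X * (1 - deriv 1); pose P1 : {poly R} := flat_deriv 1.
have [D0 D00 hD0] := flat_bounded P0; have [D1 D10 hD1] := flat_bounded P1.
have P00 : P0.[0] = 0 by rewrite /P0 hornerM hornerX mul0r.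
have P10 : P1.[0] = 0 by rewrite /P1 /flat_deriv hornerM hornerX mul0r.
(* at [y = n.+1%:R * x - 1] the weight [y + 1] is [n.+1%:R * x] *)
have flatE y : (y + 1) * flat P1 y = flat P0 y + flat P1 y.
  rewrite mulrDl mul1r; congr (_ + _).
  have [y0|y0] := leP y 0; first by rewrite !flat_le0// mulr0.
  exact: flat_mulX.
pose psi n x := g x * near0_cutoff n x.
have spsi n : smooth setT (psi n) by exact: smooth_cut_near0.
have psi0 n x : x <= 0 -> psi n x = 0.
  by move=> x0; rewrite /psi near0_cutoff0 ?mulr0// (le_trans x0).
have psi'E n x : 0 < x -> derive1 (psi n) x = derive1 g x * near0_cutoff n x +
    g x * (n.+1%:R * flat P1 (n.+1%:R * x - 1)).
  move=> x0; rewrite derive1M ?derive1_near0_cutoff//.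
    by apply: smooth_derivable sg _ _; rewrite /= in_itv/= x0.
  exact: (smooth_derivable (smooth_near0_cutoff n)).
have tailB n x : 0 < x -> `|g x * (n.+1%:R * flat P1 (n.+1%:R * x - 1))| <=
    K * `|flat P0 (n.+1%:R * x - 1) + flat P1 (n.+1%:R * x - 1)|.
  move=> x0; rewrite -flatE subrK normrM.
  apply: (le_trans (ler_wpM2r (normr_ge0 _) (gK x x0))).
  by rewrite !normrM (ger0_norm (ltW x0)); rewrite le_eqVlt; apply/orP; left; apply/eqP; ring.
have psiB n x : 0 < x -> `|psi n x| <= C.
  move=> x0; rewrite normrM (le_trans _ (hC x x0))// ler_piMr//.
  exact: cutoff_norm.
have psi'B n x : 0 < x -> `|derive1 (psi n) x| <= C' + K * (D0 + D1).
  move=> x0; rewrite psi'E// (le_trans (ler_normD _ _))// lerD//.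
    by rewrite normrM (le_trans _ (hC' x x0))// ler_piMr// cutoff_norm.
  rewrite (le_trans (tailB n x x0))// ler_wpM2l// (le_trans (ler_normD _ _))//.
  by rewrite lerD.
have En n : lap (hexp (derive1 (psi n))) s = r * lap (hexp (psi n)) s.
  apply: lap_hexp_derive1_flat => //; first exact: psi0.
    exact: bounded_onP (psiB n).
  exact: bounded_onP (psi'B n).
have cv1 : lap (hexp (psi n)) s @[n --> \oo] --> lap (hexp g) s.
  apply: (lap_hexp_cvg b02 diffu upos (C := C)) => //.
  - by move=> n; exact: smoothT_pos.
  - move=> x x0; have := cvgMr_cst (c := g x) (cvg_near0_cutoff x0).
    by rewrite mulr1.
have cv2 : lap (hexp (derive1 (psi n))) s @[n --> \oo] --> lap (hexp (derive1 g)) s.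
  apply: (lap_hexp_cvg b02 diffu upos (C := C' + K * (D0 + D1))) => //.
  - by move=> n; apply: smoothT_pos; exact: smooth_derive1.
  - move=> x x0; under eq_fun do rewrite psi'E//.
    have c0 := cvgMr_cst (c := derive1 g x) (cvg_near0_cutoff x0).
    have f1 := @flat_cvg_near0 R P0 x x0; have f2 := @flat_cvg_near0 R P1 x x0.
    rewrite P00 in f1; rewrite P10 in f2.
    have f12 : `|flat P0 (n.+1%:R * x - 1) + flat P1 (n.+1%:R * x - 1)|
        @[n --> \oo] --> `|0 + 0 : R|.
      by apply: cvg_norm; exact: cvgD.
    have := cvgMr_cst (c := K) f12; rewrite addr0 normr0 mulr0 => fK0.
    have c1 : g x * (n.+1%:R * flat P1 (n.+1%:R * x - 1)) @[n --> \oo] --> (0 : R).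
      apply: (squeeze_cvgr (f := fun n => - (K *
        `|flat P0 (n.+1%:R * x - 1) + flat P1 (n.+1%:R * x - 1)|)) _ _ fK0).
        by apply: nearW => n; rewrite -ler_norml; exact: tailB.
      by rewrite -[X in _ --> X]oppr0; exact: cvgN.
    have := cvgD c0 c1; rewrite mulr1 addr0 => h; exact: h.
apply: (@cvg_unique _ _ _ _ _ _ cv2) => //.
rewrite (_ : (fun n => _) = (fun n => r * lap (hexp (psi n)) s)).
  exact: (cvgMr_cst (c := r) cv1).
by apply/funext => n; rewrite En.
Qed.

End transform.

(** * A process observed at an independent random time *)

Section random_time.
Context {R : realType} (d : measure_display) (Om : measurableType d).
Variables (P : probability Om R) (S : Type) (X : R -> Om -> S) (tau : Om -> R).
Variable (A : set S).
Hypothesis mX : forall x, 0 <= x -> measurable (X x @^-1` A).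
Hypothesis pathsX : step_paths X.
Hypothesis mtau : measurable_fun setT tau.
Hypothesis tau0 : forall w, 0 <= tau w.
Hypothesis indep : forall (x : R) (B : set R), 0 <= x -> measurable B ->
  P (X x @^-1` A `&` tau @^-1` B) = (P (X x @^-1` A) * P (tau @^-1` B))%E.

Let q (x : R) : R := fine (P (X x @^-1` A)).

Let PE x : 0 <= x -> P (X x @^-1` A) = (q x)%:E.
Proof. by move=> x0; rewrite /q fineK// fin_num_measure//; exact: mX. Qed.

Let q01 x : 0 <= x -> 0 <= q x <= 1.
Proof.
move=> x0; rewrite -!lee_fin -PE// measure_ge0 probability_le1//; exact: mX.
Qed.

Let grid (n j : nat) : R := j.+1%:R / n.+1%:R.
Let cell n j : set Om := tau @^-1` `[j%:R / n.+1%:R, j.+1%:R / n.+1%:R[.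
Let approx n w : R := grid n (Num.trunc (n.+1%:R * tau w)).

Let cellP n w j : cell n j w <-> j = Num.trunc (n.+1%:R * tau w).
Proof.
have n0 : 0 < n.+1%:R :> R by [].
have h : 0 <= n.+1%:R * tau w by rewrite mulr_ge0.
rewrite /cell/= in_itv/= ler_pdivrMr// ltr_pdivlMr// mulrC.
split=> [/truncn_def -> //|->]; exact: truncn_itv.
Qed.

Let mcell n j : measurable (cell n j).
Proof. by rewrite /cell -[X in measurable X]setTI; exact: mtau. Qed.

Let cellT n : \bigcup_j cell n j = setT.
Proof.
apply/seteqP; split => // w _; exists (Num.trunc (n.+1%:R * tau w)) => //.
exact/cellP.
Qed.

Let trivIset_cell n : trivIset setT (cell n).
Proof. by move=> i j _ _ [w [/cellP -> /cellP ->]]. Qed.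

Let grid_ge0 n j : 0 <= grid n j.
Proof. by rewrite divr_ge0. Qed.

Let approx_gt n w : tau w < approx n w.
Proof.
have /truncn_itv/andP[_] : 0 <= n.+1%:R * tau w by rewrite mulr_ge0.
by rewrite /approx/grid ltr_pdivlMr// mulrC.
Qed.

Let approx_le n w : approx n w <= tau w + n.+1%:R^-1.
Proof.
have /truncn_itv/andP[h _] : 0 <= n.+1%:R * tau w by rewrite mulr_ge0.
rewrite /approx/grid ler_pdivrMr// mulrDl mulVf ?pnatr_eq0// (mulrC (tau w)).
by rewrite -natr1 lerD2r.
Qed.

Let approx_cvg w : approx n w @[n --> \oo] --> (tau w)^'+.
Proof.
move=> V; rewrite /at_right /within/= => -[e /= e0 eV].
have : \forall n \near \oo, (n.+1%:R^-1 : R) < e.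
  exact: near_infty_natSinv_lt (PosNum e0).
apply: filterS => n ne; apply: eV; last exact: approx_gt.
rewrite /ball_/= distrC ger0_norm ?subr_ge0 ?(ltW (approx_gt _ _))//.
by rewrite ltrBlDl (le_lt_trans (approx_le n w))// ltrD2l.
Qed.

Let indic_cvg w : \1_A (X (approx n w) w) @[n --> \oo] --> (\1_A (X (tau w) w) : R).
Proof.
apply: cvg_near_cst.
have h : \forall n \near \oo, X (approx n w) w = X (tau w) w.
  exact: (@approx_cvg w _ (pathsX w (tau0 w))).
by apply: filterS h => n ->.
Qed.

Let qE x : 0 <= x -> q x = \int[P]_w \1_A (X x w).
Proof.
move=> x0; rewrite /q /Rintegral; congr fine.
rewrite -[in LHS](setIT (X x @^-1` A)) -integral_indic//; last exact: mX.
Qed.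

Let indic_norm (s : S) : `|\1_A s| <= 1 :> R.
Proof. by rewrite indicE; case: (_ \in _); rewrite ?normr1 ?normr0. Qed.

Let measurable_indicX x : 0 <= x -> measurable_fun setT (fun w => \1_A (X x w) : R).
Proof.
move=> x0; have := @measurable_indic _ _ R setT _ (mX x0).
by congr measurable_fun.
Qed.

Let i1 : P.-integrable setT (EFin \o cst (1 : R)).
Proof. exact: finite_measure_integrable_cst. Qed.

Let q_cvg w : q (approx n w) @[n --> \oo] --> q (tau w).
Proof.
rewrite qE//.
rewrite (_ : (fun n => _) = fun n => \int[P]_v \1_A (X (approx n w) v)); last first.
  by apply/funext => n; rewrite qE// /approx.
have [|||||_ _ //] := @Rintegral_dominated R _ _ P setT _
  (fun n v => \1_A (X (approx n w) v)) (fun v => \1_A (X (tau w) v)) (cst 1).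
- by [].
- by move=> n; apply: measurable_indicX; rewrite /approx.
- move=> v _; apply: cvg_near_cst.
  have h : \forall n \near \oo, X (approx n w) v = X (tau w) v.
    exact: (@approx_cvg w _ (pathsX v (tau0 w))).
  by apply: filterS h => n ->.
- exact: i1.
- by move=> n v _; exact: indic_norm.
Qed.

Let eq_on_cell (f : R -> Om -> R) n j w : cell n j w -> f (approx n w) w = f (grid n j) w.
Proof. by move=> /cellP ->. Qed.

Let measurable_approx (f : R -> Om -> R) n :
  (forall x, 0 <= x -> measurable_fun setT (f x)) ->
  measurable_fun setT (fun w => f (approx n w) w).
Proof.
move=> mf; rewrite -(cellT n); apply/measurable_fun_bigcup => // j.
apply: (eq_measurable_fun (f (grid n j))).
  by move=> w; rewrite inE => cw; rewrite (eq_on_cell f cw).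
by apply: measurable_funTS; exact: mf.
Qed.

Let integral_approx n :
  \int[P]_w \1_A (X (approx n w) w) = \int[P]_w q (approx n w).
Proof.
rewrite /Rintegral -(cellT n); congr fine.
rewrite !ge0_integral_bigcup//=; last 3 first.
- rewrite cellT; apply/measurable_EFinP.
  by apply: (measurable_approx (f := fun x _ => q x)) => x _; exact: measurable_cst.
- by move=> w _; rewrite lee_fin; have /andP[] := @q01 (approx n w) (grid_ge0 _ _).
- rewrite cellT; apply/measurable_EFinP.
  by apply: (measurable_approx (f := fun x w => \1_A (X x w))) => x; exact: measurable_indicX.
apply: eq_eseriesr => j _.
transitivity (\int[P]_(w in cell n j) (\1_(X (grid n j) @^-1` A) w)%:E)%E.
  apply: eq_integral => w; rewrite inE => cw; congr EFin.
  by rewrite (eq_on_cell (fun x w => \1_A (X x w)) cw) !indicE.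
transitivity (\int[P]_(w in cell n j) (cst (q (grid n j)) w)%:E)%E; last first.
  apply: eq_integral => w; rewrite inE => cw; congr EFin.
  by rewrite (eq_on_cell (fun x _ => q x) cw).
rewrite integral_indic//; last exact: mX.
transitivity (P (X (grid n j) @^-1` A) * P (cell n j))%E.
  by apply: indep => //; exact: measurable_itv.
rewrite -[RHS]/(\int[P]_(w in cell n j) cst (q (grid n j))%:E w)%E.
by rewrite integral_cst// PE.
Qed.

(** Replace [tau] by the next grid point of mesh [1 / (n + 1)]. On each cell of the grid
    the process is observed at a fixed time, so independence gives the identity
    ([integral_approx]). As the mesh tends to [0] the grid points decrease to [tau] strictly from
    the right, and both sides converge by right continuity of the paths; this also makes the
    event measurable. *)
Lemma random_time_prob : measurable ((fun w => X (tau w) w) @^-1` A) /\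
  [/\ measurable_fun setT (fun w => fine (P (X (tau w) @^-1` A))) &
   P ((fun w => X (tau w) w) @^-1` A) =
    (\int[P]_w (fine (P (X (tau w) @^-1` A)))%:E)%E].
Proof.
have [|||||m1 i1' c1] := @Rintegral_dominated R _ _ P setT _
  (fun n w => \1_A (X (approx n w) w)) (fun w => \1_A (X (tau w) w)) (cst 1).
- by [].
- move=> n; apply: (measurable_approx (f := fun x w => \1_A (X x w))) => x.
  exact: measurable_indicX.
- by move=> w _; exact: indic_cvg.
- exact: i1.
- by move=> n v _; exact: indic_norm.
have [|||||m2 i2 c2] := @Rintegral_dominated R _ _ P setT _
  (fun n w => q (approx n w)) (fun w => q (tau w)) (cst 1).
- by [].
- move=> n; apply: (measurable_approx (f := fun x _ => q x)) => x _.
  exact: measurable_cst.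
- by move=> w _; exact: q_cvg.
- exact: i1.
- move=> n v _; have /andP[? ?] := @q01 (approx n v) (grid_ge0 _ _).
  by rewrite ger0_norm.
have mA : measurable ((fun w => X (tau w) w) @^-1` A).
  apply/(@measurable_indicP _ _ R).
  by move: m1; congr measurable_fun.
split => //; split => //.
have E : \int[P]_w \1_A (X (tau w) w) = \int[P]_w q (tau w).
  apply: (@cvg_unique _ _ _ _ _ _ c1) => //.
  rewrite (_ : (fun n => _) = fun n => \int[P]_w q (approx n w))//.
  by apply/funext => n; exact: integral_approx.
rewrite -[RHS]fineK; last exact: integrable_fin_num i2.
rewrite -[X in X%:E]/(\int[P]_w q (tau w)) -E /Rintegral fineK; last first.
  exact: integrable_fin_num i1'.
by rewrite -[in LHS](setIT (_ @^-1` A)) -integral_indic.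
Qed.

End random_time.

(** * Folded laws and laws on a countable state space *)

Section law.
Context {R : realType} (d : measure_display) (Om : measurableType d).
Variables (P : probability Om R).
Local Notation pos := (`]0%R, +oo[%classic : set R).

(** The law of [tau] is twice [nu] restricted to the open half line, in particular it
    does not charge the origin. *)
Lemma integral_folded_law (tau : Om -> R) (nu : probability R R) (q : R -> R) :
  measurable_fun setT tau ->
  (forall A : set R, measurable A -> P (tau @^-1` A) = (2%:E * nu (A `&` pos))%E) ->
  (forall w, 0 <= q (tau w)) -> (forall x, 0 < x -> 0 <= q x) ->
  measurable_fun setT (fun w => q (tau w)) -> measurable_fun pos q ->
  (\int[P]_w (q (tau w))%:E = 2%:E * \int[nu]_(x in pos) (q x)%:E)%E.
Proof.
move=> mtau law qt0 q0 mqt mq.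
have mpre : measurable (tau @^-1` pos) by rewrite -[X in measurable X]setTI; exact: mtau.
rewrite (@ge0_negligible_integral _ _ _ P setT (~` (tau @^-1` pos)))//; last 4 first.
- exact: measurableC.
- exact/measurable_EFinP.
- by move=> w _; rewrite lee_fin.
- rewrite preimage_setC; transitivity (2%:E * nu (~` pos `&` pos))%E.
    by apply: law; exact: measurableC.
  by rewrite setICl measure0 mule0.
rewrite setDE setTI setCK.
have q0' x : pos x -> (0 <= (q x)%:E)%E.
  by rewrite /= in_itv/= andbT lee_fin => /q0.
rewrite -[LHS](@ge0_integral_pushforward _ _ _ _ R _ mtau P pos (EFin \o q))//; last 2 first.
- exact/measurable_EFinP.
- by move=> x; rewrite inE; exact: q0'.
have two0 : 0 <= 2 :> R by [].
rewrite -(@ge0_integral_mscale _ _ R _ pos _ (NngNum two0))//; last first.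
  exact/measurable_EFinP.
apply: eq_measure_integral => A mA Apos.
by transitivity (2%:E * nu (A `&` pos))%E; [exact: law|rewrite setIidl].
Qed.

Lemma folded_law_half (tau : Om -> R) (nu : probability R R) :
  (forall A : set R, measurable A -> P (tau @^-1` A) = (2%:E * nu (A `&` pos))%E) ->
  nu pos = (2^-1)%:E.
Proof.
move=> /(_ setT measurableT); rewrite preimage_setT probability_setT setTI.
have fn : nu pos \is a fin_num by exact: fin_num_measure.
rewrite -(fineK fn) -EFinM => -[h]; congr EFin.
by apply: (@mulfI _ 2) => //; rewrite -h divff.
Qed.

(** The mass of [None] is the complement of the total mass of the states
    [Some n]. *)
Lemma eq_option_distribution d' (Om' : measurableType d') (P' : probability Om' R)
    (Y : Om -> option nat) (Y' : Om' -> option nat) :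
  (forall A, measurable (Y @^-1` A)) -> (forall A, measurable (Y' @^-1` A)) ->
  (forall n, P (Y @^-1` [set Some n]) = P' (Y' @^-1` [set Some n])) ->
  forall A, P (Y @^-1` A) = P' (Y' @^-1` A).
Proof.
move=> mY mY' E.
have noNone A : ~ A None -> P (Y @^-1` A) = P' (Y' @^-1` A).
  move=> AN; pose B n : set (option nat) := A `&` [set Some n].
  have AB : A = \bigcup_n B n.
    apply/seteqP; split=> [[n|] // An|x [n _ []] //]; first by exists n.
  have tB : trivIset setT B by move=> i j _ _ [x [[_ /= ->] [_ []]]].
  rewrite AB !preimage_bigcup !measure_bigcup//; last 2 first.
  - by move=> i j _ _ [w [/= ? ?]]; apply: tB => //; exists (Y' w).
  - by move=> i j _ _ [w [/= ? ?]]; apply: tB => //; exists (Y w).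
  apply: eq_eseriesr => n _.
  have [An|An] := pselect (A (Some n)).
    rewrite (_ : B n = [set Some n]); first exact: E.
    by apply/seteqP; split => [x []|x /= ->].
  rewrite (_ : B n = set0) ?preimage_set0 ?measure0//.
  by apply/seteqP; split => // x [+ /= xn]; rewrite xn.
move=> A; have [AN|/noNone//] := pselect (A None).
have E' : P (Y @^-1` (~` A)) = P' (Y' @^-1` (~` A)) by apply: noNone => /(_ AN).
rewrite -(setCK A) -2!preimage_setC.
rewrite (probability_setC P (mY (~` A))) (probability_setC P' (mY' (~` A))).
by congr (1 - _)%E; exact: E'.
Qed.

End law.

(** * The triangular system of the birth rates *)

Section triangular_system.
Context {R : realType}.
Local Notation pos := (`]0%R, +oo[%classic : set R).
Variables (n0 : nat) (lambda : nat -> nat -> R).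
Hypothesis lambda_gt0 : forall n i : nat, (n0 <= n)%N -> (1 <= i)%N -> 0 < lambda n i.
Hypothesis lambda_sum : forall n : nat, (n0 <= n)%N ->
  (\sum_(1 <= i <oo) (lambda n i)%:E < +oo)%E.

Definition exit_rate n : R := fine (\sum_(1 <= i <oo) (lambda n i)%:E)%E.

(** The right-hand side of the equations for the state probabilities. *)
Definition birth_rhs (v : nat -> R) (n : nat) : R :=
  - exit_rate n * v n + \sum_(1 <= i < n.+1) lambda (n - i)%N i * v (n - i)%N.

Let rate_sum_ge0 n : (n0 <= n)%N -> (0 <= \sum_(1 <= i <oo) (lambda n i)%:E)%E.
Proof.
move=> n0n; apply: nneseries_ge0 => i i1 _; rewrite lee_fin ltW//.
exact: lambda_gt0.
Qed.

Lemma exit_rate_ge0 n : (n0 <= n)%N -> 0 <= exit_rate n.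
Proof. by move=> n0n; rewrite fine_ge0// rate_sum_ge0. Qed.

Lemma exit_rateM n x : (n0 <= n)%N ->
  fine (\sum_(1 <= i <oo) (lambda n i * x)%:E)%E = exit_rate n * x.
Proof.
move=> n0n; rewrite /exit_rate mulrC -[x in RHS]/(fine x%:E) -fineM//; last first.
  by rewrite ge0_fin_numE ?lambda_sum ?rate_sum_ge0.
rewrite eseries_cond [in RHS]eseries_cond -nneseriesZl.
  by congr fine; apply: eq_eseriesr => i _; rewrite mulrC EFinM.
by move=> i /= i1; rewrite lee_fin ltW// lambda_gt0.
Qed.

(** [V] stands for a space of functions, such as the bounded or the smooth ones. *)
Lemma birth_rhs_closed (V : (R -> R) -> Prop) (p : nat -> R -> R) n :
  V (cst 0) -> (forall f g, V f -> V g -> V (fun x => f x + g x)) ->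
  (forall c f, V f -> V (fun x => c * f x)) ->
  (forall k, V (p k)) -> V (fun x => birth_rhs (p^~ x) n).
Proof.
move=> V0 VD VZ Vp; apply: (VD _ _ (VZ _ _ (Vp n))).
elim: (index_iota 1 n.+1) => [|i r IH].
  by under eq_fun do rewrite big_nil.
by under eq_fun do rewrite big_cons; exact: VD (VZ _ _ (Vp _)) IH.
Qed.

Lemma birth_rhs_linear (V : (R -> R) -> Prop) (L : (R -> R) -> R)
    (p : nat -> R -> R) n :
  V (cst 0) -> (forall f g, V f -> V g -> V (fun x => f x + g x)) ->
  (forall c f, V f -> V (fun x => c * f x)) ->
  L (cst 0) = 0 -> (forall f g, V f -> V g -> L (fun x => f x + g x) = L f + L g) ->
  (forall c f, V f -> L (fun x => c * f x) = c * L f) ->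
  (forall k, V (p k)) ->
  L (fun x => birth_rhs (p^~ x) n) = birth_rhs (fun k => L (p k)) n.
Proof.
move=> V0 VD VZ L0 LD LZ Vp; rewrite /birth_rhs.
pose S (r : seq nat) x := \sum_(i <- r) lambda (n - i)%N i * p (n - i)%N x.
have [VS LS] : V (S (index_iota 1 n.+1)) /\ L (S (index_iota 1 n.+1)) =
    \sum_(1 <= i < n.+1) lambda (n - i)%N i * L (p (n - i)%N).
  elim: (index_iota 1 n.+1) => [|i r [VS LS]].
    by rewrite /S big_nil; under eq_fun do rewrite big_nil.
  rewrite /S big_cons; under eq_fun do rewrite big_cons.
  by split; [exact: VD (VZ _ _ (Vp _)) VS|rewrite LD ?LZ ?LS//; exact: VZ].
by rewrite LD ?LZ ?LS//; exact: VZ.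
Qed.

(** The equation for [a n] involves only smaller indices besides [a n], with the positive
    coefficient [r + exit_rate n]. *)
Lemma triangular_unique (a b c : nat -> R) (r : R) : 0 < r ->
  (forall n, (n < n0)%N -> a n = b n) ->
  (forall n, (n0 <= n)%N -> r * (a n - c n) = birth_rhs a n) ->
  (forall n, (n0 <= n)%N -> r * (b n - c n) = birth_rhs b n) ->
  forall n, a n = b n.
Proof.
move=> r0 lt_n0 ha hb n; have [m] := ubnP n; elim: m n => // m IH n nm.
have [/lt_n0//|n0n] := ltnP n n0.
have := congr2 (fun x y => x - y) (ha n n0n) (hb n n0n); rewrite /birth_rhs.
rewrite (_ : \sum_(1 <= i < n.+1) lambda (n - i) i * a (n - i)%N =
  \sum_(1 <= i < n.+1) lambda (n - i) i * b (n - i)%N); last first.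
  rewrite !big_nat; apply: eq_bigr => i /andP[i1 ni]; rewrite IH//.
  by rewrite (@leq_trans n)// ltn_subrL i1 (leq_trans i1).
move=> h; have e0 := exit_rate_ge0 n0n.
have re : r + exit_rate n != 0 by rewrite gt_eqF// ltr_wpDr.
apply: (mulfI re); apply/eqP; rewrite -subr_eq0; apply/eqP.
by move: h; set S := \sum_(_ <= _ < _) _; lra.
Qed.

End triangular_system.

(** * Transforms of the state probabilities *)

Section birth_process.
Context {R : realType}.
Local Notation pos := (`]0%R, +oo[%classic : set R).
Variables (n0 : nat) (lambda : nat -> nat -> R).
Hypothesis lambda_gt0 : forall n i : nat, (n0 <= n)%N -> (1 <= i)%N -> 0 < lambda n i.
Hypothesis lambda_sum : forall n : nat, (n0 <= n)%N ->
  (\sum_(1 <= i <oo) (lambda n i)%:E < +oo)%E.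
Variables (alpha : R) (d : measure_display) (Om : measurableType d).
Variables (P : probability Om R) (X : R -> Om -> option nat).
Hypotheses (alpha_gt0 : 0 < alpha) (alpha_le1 : alpha <= 1).
Hypothesis birthX : fractional_birth_process n0 alpha lambda P X.
Local Notation p := (state_prob P X).

Lemma state_prob_bound n t : 0 <= t -> 0 <= p n t <= 1.
Proof.
have [mX _ _ _ _] := birthX => t0; have mXn := mX t [set Some n] t0.
rewrite -!lee_fin /state_prob fineK ?fin_num_measure//.
by rewrite measure_ge0 probability_le1.
Qed.

Lemma state_prob_norm n t : 0 <= t -> `|p n t| <= 1.
Proof. by move=> /(state_prob_bound n)/andP[? ?]; rewrite ger0_norm. Qed.

Lemma state_prob_bounded_on n : bounded_on pos (p n).
Proof. by apply: (bounded_onP (C := 1)) => t /ltW; exact: state_prob_norm. Qed.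

Lemma state_prob_initial n : (n0 <= n)%N -> p n 0 = (n == n0)%:R.
Proof.
have [_ _ p0 pn _] := birthX; rewrite leq_eqVlt => /predU1P[<-|nn].
  by rewrite p0 eqxx.
by rewrite pn// gtn_eqF.
Qed.

Lemma state_prob_measurable n : measurable_fun pos (p n).
Proof.
have [_ pn0 _ _ /(_ n) Dp] := birthX; have [nn0|n0n] := ltnP n n0.
  apply: (eq_measurable_fun (cst 0 : R -> R)); last exact: measurable_cst.
  by move=> t; rewrite inE/= in_itv/= andbT => t0; rewrite pn0// ltW.
by have [Dc _] := Dp n0n; exact: caputo_measurable Dc alpha_gt0.
Qed.

Lemma state_prob_continuous n t : (n0 <= n)%N -> 0 < t -> {for t, continuous (p n)}.
Proof.
have [_ _ _ _ Dp] := birthX => n0n t0; have [[_ ac _] _] := Dp n n0n.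
apply: loc_abs_cont_continuous => //; apply: (ac 0%N).
by rewrite caputo_degree1// alpha_gt0.
Qed.

Lemma caputo_state_prob n t : (n0 <= n)%N -> 0 < t ->
  caputo alpha (p n) t = birth_rhs lambda (p^~ t) n.
Proof.
move=> n0n t0; have [_ _ _ _ Dp] := birthX; have [_ ->] := Dp n n0n => //.
by rewrite (exit_rateM lambda_gt0 lambda_sum)// /birth_rhs mulNr.
Qed.

Lemma lap_state_prob n s : (n0 <= n)%N -> 0 < s ->
  s `^ alpha * (lap (p n) s - p n 0 / s) =
  birth_rhs lambda (fun k => lap (p k) s) n.
Proof.
move=> n0n s0; have [_ _ _ _ Dp] := birthX; have [Dc _] := Dp n n0n.
pose G t := birth_rhs lambda (p^~ t) n.
have mG : measurable_fun pos G.
  apply: (@birth_rhs_closed _ _ (fun f => measurable_fun pos f)).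
  - exact: measurable_cst.
  - by move=> f g; exact: measurable_funD.
  - by move=> c f mf; apply: measurable_funM.
  - exact: state_prob_measurable.
have [C C0 hC] : exists2 C : R, 0 <= C & forall t, 0 < t -> `|G t| <= C.
  apply: bounded_onE; apply: (@birth_rhs_closed _ _ (bounded_on pos)).
  - exact: bounded_on_cst.
  - by move=> f g; exact: bounded_onD.
  - by move=> c f bf; apply: bounded_onM => //; exact: bounded_on_cst.
  - exact: state_prob_bounded_on.
rewrite -(@lap_caputo R alpha (p n) s 1 C)//.
- rewrite (eq_lap (g := G)) => [|t t0]; last exact: caputo_state_prob.
  apply: (@birth_rhs_linear _ _ (fun f => lap_integrable f s) (fun f => lap f s)).
  - by apply: (bounded_lap_integrable (C := 0)) => // t _; rewrite normr0.
  - by move=> f g fs gs; case: (lapD fs gs).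
  - by move=> c f fs; case: (lapZ c fs).
  - by rewrite /lap; under eq_Rintegral do rewrite mulr0; rewrite Rintegral_cst//= mul0r.
  - by move=> f g fs gs; case: (lapD fs gs).
  - by move=> c f fs; case: (lapZ c fs).
  - move=> k; apply: (bounded_lap_integrable (C := 1)) => //.
      exact: state_prob_measurable.
    by move=> t /ltW; exact: state_prob_norm.
- by rewrite alpha_gt0 (le_trans alpha_le1)// ler1n.
- by move=> a1; move: alpha_le1; rewrite leNgt a1.
- by move=> t /ltW; exact: state_prob_norm.
- apply: (eq_measurable_fun G) => // t; rewrite inE/= in_itv/= andbT => t0.
  by rewrite caputo_state_prob.
- by move=> t t0; rewrite caputo_state_prob//; exact: hC.
Qed.

End birth_process.

Section markovian.
Context {R : realType}.
Local Notation pos := (`]0%R, +oo[%classic : set R).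
Variables (n0 : nat) (lambda : nat -> nat -> R).
Hypothesis lambda_gt0 : forall n i : nat, (n0 <= n)%N -> (1 <= i)%N -> 0 < lambda n i.
Hypothesis lambda_sum : forall n : nat, (n0 <= n)%N ->
  (\sum_(1 <= i <oo) (lambda n i)%:E < +oo)%E.
Variables (d : measure_display) (Om : measurableType d).
Variables (P : probability Om R) (X : R -> Om -> option nat).
Hypothesis birthX : fractional_birth_process n0 1 lambda P X.
Local Notation p := (state_prob P X).

Lemma derivable_state_prob n t : (n0 <= n)%N -> 0 < t -> derivable (p n) t 1.
Proof.
have [_ _ _ _ Dp] := birthX => n0n t0; have [[_ _ /(_ t t0) +] _] := Dp n n0n.
by rewrite caputo_degree1 ?ltr01 ?lexx//= eqxx.
Qed.

Lemma derive1_state_prob n t : (n0 <= n)%N -> 0 < t ->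
  derive1 (p n) t = birth_rhs lambda (p^~ t) n.
Proof.
move=> n0n t0.
rewrite -(caputo_state_prob lambda_gt0 lambda_sum birthX n0n t0).
by rewrite /caputo caputo_degree1 ?ltr01 ?lexx//= eqxx.
Qed.

(** The equation expresses the derivative of [p n] by finitely many of the [p k]. *)
Lemma smooth_state_prob n : smooth pos (p n).
Proof.
move=> k; elim: k n => // k IH n; have [nn0|n0n] := ltnP n n0.
  apply: (@ck_ext _ _ _ (cst 0)); [exact: open_pos| |exact: ck_cst].
  move=> t /=; rewrite in_itv/= andbT => t0.
  by have [_ pn0 _ _ _] := birthX; rewrite pn0// ltW.
split=> [t|].
  by rewrite /= in_itv/= andbT => t0; exact: derivable_state_prob.
apply: (@ck_ext _ _ _ (fun t => birth_rhs lambda (p^~ t) n)); first exact: open_pos.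
  by move=> t /=; rewrite in_itv/= andbT => t0; rewrite derive1_state_prob.
apply: (@birth_rhs_closed _ _ (ck k pos)) => //.
- exact: ck_cst.
- by move=> f g; exact: ckD open_pos.
- by move=> c f; exact: ckZ open_pos.
Qed.

Lemma bounded_smooth_state_prob n : bounded_smooth (p n).
Proof. by split; [exact: smooth_state_prob|exact: state_prob_bounded_on birthX _]. Qed.

Lemma bounded_smooth_birth_rhs n :
  bounded_smooth (fun t => birth_rhs lambda (p^~ t) n).
Proof.
apply: (@birth_rhs_closed _ _ bounded_smooth).
- exact: bounded_smooth_cst.
- exact: bounded_smoothD.
- exact: bounded_smoothZ.
- exact: bounded_smooth_state_prob.
Qed.

Lemma bounded_smooth_derive1_state_prob n : (n0 <= n)%N ->
  bounded_smooth (derive1 (p n)).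
Proof.
move=> n0n; split; first exact: smooth_derive1 (smooth_state_prob n).
have [_ /bounded_onE[C _ hC]] := bounded_smooth_birth_rhs n.
by apply: (bounded_onP (C := C)) => t t0; rewrite derive1_state_prob// hC.
Qed.

(** Mean value theorem; the derivative is bounded by the equation, and continuity at
    the origin is part of the definition of a solution. *)
Lemma state_prob_lipschitz n : (n0 <= n)%N ->
  exists K : R, forall t, 0 < t -> `|p n t - p n 0| <= K * t.
Proof.
move=> n0n; have [_ /bounded_onE[C _ hC]] := bounded_smooth_derive1_state_prob n0n.
exists C => t t0; have [_ _ _ _ Dp] := birthX.
have [[p0 _ _] _] := Dp n n0n.
have cn : {within `[0, t], continuous (p n)}.
  apply/(continuous_within_itvP _ t0); split => //.
    move=> x; rewrite in_itv/= => /andP[x0 _].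
    exact: (state_prob_continuous _ _ birthX).
  apply: cvg_at_left_filter; exact: (state_prob_continuous _ _ birthX).
have dp x : x \in `]0, t[%R -> is_derive x (1 : R) (p n) (derive1 (p n) x).
  rewrite in_itv/= => /andP[x0 _]; rewrite derive1E; apply: derivableP.
  exact: derivable_state_prob.
have [x + ->] := MVT t0 dp cn; rewrite in_itv/= => /andP[x0 _].
by rewrite subr0 normrM (gtr0_norm t0) ler_pM2r// hC.
Qed.

Variables (alpha : R) (u : R -> probability R R).
Hypotheses (alpha_gt0 : 0 < alpha) (alpha_le1 : alpha <= 1).
Hypothesis diffu : fractional_diffusion (2 * alpha) u.
Hypothesis upos : forall t, 0 < t -> u t pos = (2^-1)%:E.

Let b02 : 0 < 2 * alpha <= 2.
Proof. by rewrite mulr_gt0//= -[leRHS]mulr1 ler_pM2l. Qed.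

(** The first order identity of the diffusion replaces the derivative of [p n] by the
    same expression that the Caputo derivative produces in [lap_state_prob]. *)
Lemma lap_hexp_state_prob n s : (n0 <= n)%N -> 0 < s ->
  s `^ alpha * (lap (hexp u (p n)) s - p n 0 / s) =
  birth_rhs lambda (fun k => lap (hexp u (p k)) s) n.
Proof.
move=> n0n s0; have [K hK] := state_prob_lipschitz n0n.
rewrite -(lap_hexp_derive1 b02 diffu upos (bounded_smooth_state_prob n)
  (bounded_smooth_derive1_state_prob n0n) hK s0)//; last 2 first.
- exact: powR_gt0.
- by rewrite mulrC powRrM -powR_mulrn// powR_ge0.
transitivity (lap (hexp u (fun t => birth_rhs lambda (p^~ t) n)) s).
  by apply: eq_lap => t t0; apply: eq_hexp => x x0; exact: derive1_state_prob.
apply: (@birth_rhs_linear _ _ bounded_smooth (fun f => lap (hexp u f) s)).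
- exact: bounded_smooth_cst.
- exact: bounded_smoothD.
- exact: bounded_smoothZ.
- by rewrite lap_hexp_cst// mul0r.
- by move=> f g bf bg; exact: (lap_hexpD b02 diffu upos).
- by move=> c f bf; exact: (lap_hexpZ b02 diffu upos).
- exact: bounded_smooth_state_prob.
Qed.

End markovian.

(** * The subordination theorem *)

Unset Implicit Arguments.

Theorem mainTheorem7 (R : realType) (n0 : nat) (alpha : R)
    (lambda : nat -> nat -> R)
    (alpha_gt0 : 0 < alpha) (alpha_le1 : alpha <= 1)
    (lambda_gt0 : forall n i : nat, (n0 <= n)%N -> (1 <= i)%N -> 0 < lambda n i)
    (lambda_sum : forall n : nat, (n0 <= n)%N ->
       (\sum_(1 <= i <oo) (lambda n i)%:E < +oo)%E)
    (d1 : measure_display) (Om1 : measurableType d1) (P1 : probability Om1 R)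
    (Xalpha : R -> Om1 -> option nat)
    (Xalpha_birth : fractional_birth_process n0 alpha lambda P1 Xalpha)
    (d2 : measure_display) (Om2 : measurableType d2) (P2 : probability Om2 R)
    (X : R -> Om2 -> option nat)
    (X_birth : fractional_birth_process n0 1 lambda P2 X)
    (X_paths : step_paths X)
    (T : R -> Om2 -> R)
    (T_diffusion : folded_diffusion_process (2 * alpha) P2 T)
    (X_T_indep : independent_events P2
       (process_events `[0, +oo[ [set: set (option nat)] X)
       (process_events `]0, +oo[ (@measurable _ R) T)) :
  forall t : R, 0 < t ->
    eq_in_distribution P1 (Xalpha t) P2 (time_change X T t)
      [set: set (option nat)].
Proof.
have [mT T_ge0 [u [diffu lawT]]] := T_diffusion.
have law r : 0 < r -> forall A : set R, measurable A ->
    P2 (T r @^-1` A) = (2%:E * u r (A `&` `]0%R, +oo[))%E.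
  by move=> r0 A; exact: lawT.
have upos r : 0 < r -> u r `]0%R, +oo[%classic = (2^-1)%:E.
  by move=> r0; exact: folded_law_half (law r r0).
have [mXa _ _ _ _] := Xalpha_birth.
have [mX Xlt _ _ _] := X_birth.
pose p := state_prob P2 X; pose pa := state_prob P1 Xalpha.
(* both families of transforms solve the same triangular system *)
have lap_eq s : 0 < s -> forall n, lap (pa n) s = lap (hexp u (p n)) s.
  move=> s0; apply: (@triangular_unique _ _ _ lambda_gt0 _ _
    (fun n => (n == n0)%:R / s) (s `^ alpha)).
  - exact: powR_gt0.
  - move=> n nn0; have [_ pa0 _ _ _] := Xalpha_birth.
    apply: eq_lap => r r0; rewrite /pa pa0 ?ltW//.
    rewrite (@eq_hexp _ u _ (cst 0)) ?hexp_cst// => x x0.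
    by rewrite /p Xlt// ltW.
  - move=> n n0n.
    rewrite -(state_prob_initial Xalpha_birth n0n).
    exact: (lap_state_prob lambda_gt0 lambda_sum alpha_gt0 alpha_le1 Xalpha_birth).
  - move=> n n0n; rewrite -(state_prob_initial X_birth n0n).
    exact: (lap_hexp_state_prob lambda_gt0 lambda_sum X_birth alpha_gt0 alpha_le1 diffu upos).
have b02 : 0 < 2 * alpha <= 2 by rewrite mulr_gt0//= -[leRHS]mulr1 ler_pM2l.
have bp n := bounded_smooth_state_prob lambda_gt0 lambda_sum X_birth n.
(* equality of the transforms gives equality at each time, by continuity *)
have pE n t : 0 < t -> pa n t = hexp u (p n) t.
  move=> t0; have [nn0|n0n] := ltnP n n0.
    have [_ pa0 _ _ _] := Xalpha_birth; rewrite /pa pa0 ?ltW//.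
    rewrite (@eq_hexp _ u _ (cst 0)) ?hexp_cst// => x x0.
    by rewrite /p Xlt// ltW.
  have [sp /bounded_onE[C _ pC]] := bp n.
  have mpa : measurable_fun (`]0, +oo[ : set R) (pa n).
    exact: state_prob_measurable alpha_gt0 Xalpha_birth n.
  have pa1 r : 0 < r -> `|pa n r| <= 1.
    by move=> /ltW; exact: (state_prob_norm Xalpha_birth).
  have mh := hexp_measurable b02 diffu upos (bp n).
  have hC r : 0 < r -> `|hexp u (p n) r| <= C.
    by move=> r0; apply: hexp_norm => //; exact: smooth_measurable.
  pose h r := pa n r + - 1 * hexp u (p n) r.
  have nullh : lap_null h.
    split.
    - by apply: measurable_funD => //; exact: measurable_funM.
    - exists (1 + C) => r r0; rewrite /h mulN1r.
      by rewrite (le_trans (ler_normB _ _))// lerD ?pa1 ?hC.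
    - move=> s s0; have ia := bounded_lap_integrable s0 mpa pa1.
      have ih := bounded_lap_integrable s0 mh hC.
      have [ih' eh] := lapZ (- 1) ih; have [_ ->] := lapD ia ih'.
      by rewrite eh lap_eq// mulN1r subrr.
  apply/eqP; rewrite -subr_eq0 -mulN1r; apply/eqP.
  apply: (lap_unique nullh t0); apply: cvgD.
    exact: (state_prob_continuous alpha_gt0 alpha_le1 Xalpha_birth).
  apply: cvgM; first exact: cvg_cst.
  exact: (hexp_continuous b02 diffu upos sp pC).
move=> t t0 A _.
have indep (S : set (option nat)) (x : R) (B : set R) : 0 <= x -> measurable B ->
    P2 (X x @^-1` S `&` T t @^-1` B) = (P2 (X x @^-1` S) * P2 (T t @^-1` B))%E.
  move=> x0 mB; apply: X_T_indep; apply: sub_sigma_algebra.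
    by exists x; [rewrite /= in_itv/= x0|exists S].
  by exists t; [rewrite /= in_itv/= t0|exists B].
have RT S := @random_time_prob R d2 Om2 P2 (option nat) X (T t) S
  (fun x x0 => mX x S x0) X_paths (mT t t0) (fun w => T_ge0 t w t0) (@indep S).
apply: (@eq_option_distribution _ _ _ P1 _ _ P2 (Xalpha t) (time_change X T t)).
- by move=> S; apply: mXa; exact: ltW.
- by move=> S; have [] := RT S.
move=> n; have [_ [mq PT]] := RT [set Some n].
have t0' := ltW t0.
transitivity ((pa n t)%:E); first by rewrite /pa /state_prob fineK ?fin_num_measure//; exact: mXa.
rewrite pE//; transitivity (\int[P2]_w (p n (T t w))%:E)%E; last by rewrite PT.
rewrite (integral_folded_law (q := p n) (mT t t0) (law t t0))//.
- rewrite /hexp EFinM; congr (_ * _)%E; rewrite /Rintegral fineK//.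
  apply: integrable_fin_num => //; apply: integrable_bounded.
    exact: smooth_measurable (proj1 (bp n)).
  exact: (proj2 (bp n)).
- by move=> w; have /andP[] := state_prob_bound X_birth n (T_ge0 t w t0).
- by move=> x /ltW x0; have /andP[] := state_prob_bound X_birth n x0.
- exact: smooth_measurable (proj1 (bp n)).
Qed.
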